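(* Suppose there exist an increasing sequence of positive integers $n_1<n_2<\cdots$ and, for each $t$, a finite abelian group $G_t$ together with $n_t$ pairs $(A_{t,i},B_{t,i})_{i=1}^{n_t}$ of subsets of $G_t$ satisfying the SDPP, such that $\log|G_t|/\log n_t\to2$ and $\min_i\log(|A_{t,i}||B_{t,i}|)/\log n_t\to2$ as $t\to\infty$. Then for every $\varepsilon>0$ there exists $c>0$ such that $\mathrm{val}(\mathbb{Z}_n)\ge c\,n^{4/3-\varepsilon}$ for all positive integers $n$.
   Context: For an abelian group $G$ written additively, pairs of subsets $(A_i,B_i)_{i=1}^m$ satisfy the simultaneous double product property (SDPP) if (1) for every $i$, $a-a'=b-b'$ with $a,a'\in A_i,b,b'\in B_i$ only has the solution $a=a',b=b'$; and (2) whenever $a_i-a'_j+b_j-b'_l=0$ with $a_i\in A_i,a'_j\in A_j,b_j\in B_j,b'_l\in B_l$, then $i=l$. A triple $(A,B,C)$ of subsets of $\mathbb{Z}_n$ is equilateral trapezoid-free if for every fixed $a'\in A,b'\in B,c'\in C$ each of the systems $0=a'+b+c=a+b'+c$; $0=a'+b+c=a+b+c'$; $0=a+b'+c=a+b+c'$ has at most one solution $(a,b,c)\in A\times B\times C$; $\mathrm{val}(\mathbb{Z}_n)$ is the maximum over such triples of the number of $(a,b,c)\in A\times B\times C$ with $a+b+c=0$. (The hypothesis is Conjecture 4.7 of Cohn–Kleinberg–Szegedy–Umans.) *)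

(* Defs.v *)
From HB Require Import structures.
From mathcomp Require Import all_boot all_order all_algebra.

Set Implicit Arguments.
Unset Strict Implicit.
Unset Printing Implicit Defensive.

Import Order.TTheory GRing.Theory Num.Theory.

Local Open Scope ring_scope.

Definition simultaneous_double_product (G : finZmodType) (m : nat) (A B : 'I_m -> {set G}) : Prop :=
  (forall (i : 'I_m) (a a' b b' : G),
     a \in A i -> a' \in A i -> b \in B i -> b' \in B i ->
     a - a' = b - b' -> a = a' /\ b = b') /\
  (forall (i j l : 'I_m) (a a' b b' : G),
     a \in A i -> a' \in A j -> b \in B j -> b' \in B l ->
     a - a' + b - b' = 0 -> i = l).

(* A triple (a, b, c) is encoded as t = ((a, b), c), that is, a = t.1.1,
   b = t.1.2 and c = t.2. *)
Definition equilateral_trapezoid_free (G : finZmodType) (A B C : {set G}) :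
    bool :=
  [forall a' in A, forall b' in B, forall c' in C,
    [&& (#|[set t in setX (setX A B) C |
             ((0 == a' + t.1.2 + t.2) && (0 == t.1.1 + b' + t.2))%R]| <= 1)%N,
        (#|[set t in setX (setX A B) C |
             ((0 == a' + t.1.2 + t.2) && (0 == t.1.1 + t.1.2 + c'))%R]| <= 1)%N
      & (#|[set t in setX (setX A B) C |
             ((0 == t.1.1 + b' + t.2) && (0 == t.1.1 + t.1.2 + c'))%R]| <= 1)%N]].

(* The family of trapezoid-free triples (A, B, C) is nonempty, as it contains
   the triple of empty sets, so the \max below is a genuine maximum. *)
Definition trapezoid_val (G : finZmodType) : nat :=
  (\max_(S : {set G} * {set G} * {set G}
         | equilateral_trapezoid_free S.1.1 S.1.2 S.2)
     #|[set t in setX (setX S.1.1 S.1.2) S.2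
            | (t.1.1 + t.1.2 + t.2 == 0)%R]|)%N.

(* Main.v *)
Require Import Defs.
From HB Require Import structures.
From mathcomp Require Import all_boot all_order all_algebra all_fingroup all_solvable.
From mathcomp Require Import mxabelem.
From mathcomp Require Import zify ring lra.
From mathcomp Require boolp.

(* If (A_i, B_i) has the SDPP in G with n pairs, a family of triples of indices
   without triangles (Behrend) turns it into a simultaneous triple product
   structure in G^3, hence into a trapezoid-free triple; with |G| close to n^2
   and |A_i||B_i| close to n^2 it has about n^8 solutions in a group of order
   about n^6. Passing to powers G^k and then to Z_N by a Freiman embedding costs
   a factor 2^(O(k r)), where r is the rank of G, so the point is to show that r
   is negligible compared with ln n. G contains (Z_p)^r for some prime p.
   The polynomial method yields s = |G| exp(-c r) linear conditions such that
   the sum of f(x)g(y)h(z) over x + y + z = 0 vanishes when f, g, h satisfy them.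
   The SDPP forces s to be large: among the h satisfying the conditions and
   supported on the differences b - a with a, b in a common pair, choose one for
   which the matrix h(b - a) has maximal rank. This block diagonal matrix has
   rank at most 2s, while maximality bounds the rank of each block from below,
   so that n^2 min |A_i||B_i| <= s (4|G| + n^2). *)

Set Implicit Arguments.
Unset Strict Implicit.
Unset Printing Implicit Defensive.

Import Order.TTheory GRing.Theory Num.Theory.

Local Open Scope ring_scope.

(** * From simultaneous double products to trapezoid-free triples *)

(* The three sets are those of the differences of matched labels, al - be,
   be - ga and ga - al: the labels of two of x', y', z' already determine the
   element of the third set in each of the three systems. *)
Lemma trapezoid_val_ge (G : finZmodType) (V TP TQ TR : finType)
    (lP : TP -> V) (lQ : TQ -> V) (lR : TR -> V)
    (P : {set TP}) (Q : {set TQ}) (R : {set TR})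
    (al : TP -> G) (be : TQ -> G) (ga : TR -> G) :
  (forall p p' q q' r r', p \in P -> p' \in P -> q \in Q -> q' \in Q ->
     r \in R -> r' \in R -> lP p = lQ q -> lQ q' = lR r -> lR r' = lP p' ->
     (al p - be q) + (be q' - ga r) + (ga r' - al p') = 0 ->
     [/\ p = p', q = q' & r = r']) ->
  (#|[set t : TP * TQ * TR |
       [&& t.1.1 \in P, t.1.2 \in Q, t.2 \in R,
           lP t.1.1 == lQ t.1.2 & lQ t.1.2 == lR t.2]]| <= trapezoid_val G)%N.
Proof.
move=> stpp.
pose X := [set al u.1 - be u.2 | u : TP * TQ in
  [set u | [&& u.1 \in P, u.2 \in Q & lP u.1 == lQ u.2]]].
pose Y := [set be u.1 - ga u.2 | u : TQ * TR in
  [set u | [&& u.1 \in Q, u.2 \in R & lQ u.1 == lR u.2]]].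
pose Z := [set ga u.1 - al u.2 | u : TR * TP in
  [set u | [&& u.1 \in R, u.2 \in P & lR u.1 == lP u.2]]].
have inX x : x \in X -> exists p q, [/\ p \in P, q \in Q, lP p = lQ q & x = al p - be q].
  by case/imsetP => -[p q]; rewrite inE /= => /and3P[? ? /eqP ?] ->; exists p, q.
have inY x : x \in Y -> exists p q, [/\ p \in Q, q \in R, lQ p = lR q & x = be p - ga q].
  by case/imsetP => -[p q]; rewrite inE /= => /and3P[? ? /eqP ?] ->; exists p, q.
have inZ x : x \in Z -> exists p q, [/\ p \in R, q \in P, lR p = lP q & x = ga p - al q].
  by case/imsetP => -[p q]; rewrite inE /= => /and3P[? ? /eqP ?] ->; exists p, q.
have Xin p q : p \in P -> q \in Q -> lP p = lQ q -> al p - be q \in X.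
  by move=> pP qQ e; apply/imsetP; exists (p, q); rewrite // inE /= pP qQ e eqxx.
have Yin p q : p \in Q -> q \in R -> lQ p = lR q -> be p - ga q \in Y.
  by move=> pP qQ e; apply/imsetP; exists (p, q); rewrite // inE /= pP qQ e eqxx.
have Zin p q : p \in R -> q \in P -> lR p = lP q -> ga p - al q \in Z.
  by move=> pP qQ e; apply/imsetP; exists (p, q); rewrite // inE /= pP qQ e eqxx.
have free : equilateral_trapezoid_free X Y Z.
  apply/forall_inP => x' /inX[p1 [q1 [p1P q1Q l1 ->]]].
  apply/forall_inP => y' /inY[q2 [r2 [q2Q r2R l2 ->]]].
  apply/forall_inP => z' /inZ[r3 [p3 [r3R p3P l3 ->]]].
  apply/and3P; split; apply/card_le1_eqP => -[[x y] z] -[[u v] w];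
    rewrite !inE /= => /andP[/andP[/andP[xX yY] zZ] /andP[/eqP e1 /eqP e2]]
      /andP[/andP[/andP[uX vY] wZ] /andP[/eqP e3 /eqP e4]].
  - have key x0 y0 z0 : x0 \in X -> y0 \in Y -> z0 \in Z ->
        0 = al p1 - be q1 + y0 + z0 -> 0 = x0 + (be q2 - ga r2) + z0 ->
        z0 = ga r2 - al p1.
      move=> /inX[p [q [pP qQ l ->]]] /inY[q' [r [q'Q rR l' ->]]].
      move=> /inZ[r' [p' [r'R p'P l'' ->]]] /esym/stpp E1 /esym/stpp E2.
      have [] := E1 => // -> _ _; have [] := E2 => // _ _ -> //.
    have ez : z = w by rewrite (key x y z) // (key u v w).
    subst w; congr (_, _, _).
      by apply: (addIr (be q2 - ga r2)); apply: (addIr z); rewrite -e2.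
    by apply: (addrI (al p1 - be q1)); apply: (addIr z); rewrite -e1.
  - have key x0 y0 z0 : x0 \in X -> y0 \in Y -> z0 \in Z ->
        0 = al p1 - be q1 + y0 + z0 -> 0 = x0 + y0 + (ga r3 - al p3) ->
        y0 = be q1 - ga r3.
      move=> /inX[p [q [pP qQ l ->]]] /inY[q' [r [q'Q rR l' ->]]].
      move=> /inZ[r' [p' [r'R p'P l'' ->]]] /esym/stpp E1 /esym/stpp E2.
      have [] := E1 => // _ -> _; have [] := E2 => // _ _ -> //.
    have ey : y = v by rewrite (key x y z) // (key u v w).
    subst v; congr (_, _, _).
      by apply: (addIr y); apply: (addIr (ga r3 - al p3)); rewrite -e2.
    by apply: (addrI (al p1 - be q1 + y)); rewrite -e1.
  - have key x0 y0 z0 : x0 \in X -> y0 \in Y -> z0 \in Z ->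
        0 = x0 + (be q2 - ga r2) + z0 -> 0 = x0 + y0 + (ga r3 - al p3) ->
        x0 = al p3 - be q2.
      move=> /inX[p [q [pP qQ l ->]]] /inY[q' [r [q'Q rR l' ->]]].
      move=> /inZ[r' [p' [r'R p'P l'' ->]]] /esym/stpp E1 /esym/stpp E2.
      have [] := E1 => // _ -> _; have [] := E2 => // -> _ _ //.
    have ex : x = u by rewrite (key x y z) // (key u v w).
    subst u; congr (_, _, _).
      by apply: (addrI x); apply: (addIr (ga r3 - al p3)); rewrite -e2.
    by apply: (addrI (x + (be q2 - ga r2))); rewrite -e1.
apply: leq_trans (leq_bigmax_cond (X, Y, Z) free) => /=.
set E := [set t | _]; pose h (t : TP * TQ * TR) :=
  (al t.1.1 - be t.1.2, be t.1.2 - ga t.2, ga t.2 - al t.1.1).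
have h_inj : {in E &, injective h}.
  move=> [[p q] r] [[p' q'] r']; rewrite !inE /=.
  move=> /and5P[pP qQ rR /eqP l1 /eqP l2] /and5P[pP' qQ' rR' /eqP l1' /eqP l2'].
  case=> e1 e2 e3.
  have [] := @stpp p p' q q' r' r'; rewrite ?l1' ?l2' //.
    by rewrite e1 !addrA !subrK subrr.
  move=> pp qq _; subst p' q'.
  have [] := @stpp p p q q r r'; rewrite -?l2' -?l1' ?l1 //.
    by rewrite e2 !addrA !subrK subrr.
  by move=> _ _ ->.
rewrite -(card_in_imset h_inj); apply/subset_leq_card/subsetP => y.
case/imsetP => -[[p q] r]; rewrite inE /= => /and5P[pP qQ rR /eqP l1 /eqP l2] ->.
by rewrite !inE /= Xin ?Yin ?Zin ?l1 ?l2 //= !addrA !subrK subrr.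
Qed.

(** Positivity takes care of the small moduli in [geometric_growth]. *)
Lemma trapezoid_val_gt0 (N : nat) : (0 < trapezoid_val 'I_N.+1)%N.
Proof.
have ge := @trapezoid_val_ge 'I_N.+1 unit unit unit unit id id id setT setT setT
   (fun=> 0) (fun=> 0) (fun=> 0).
apply: (leq_trans _ (ge _)); last by do 6 case.
by apply/card_gt0P; exists (tt, tt, tt); rewrite !inE.
Qed.

(** * Triangle-free families of index triples *)

(** The three equalities are those that the three base-[W] digits produce in
    [trapezoid_val_sdpp]. *)
Definition triangle_free (I : finType) (S : {set I * I * I}) :=
  forall u v w, u \in S -> v \in S -> w \in S ->
    v.1.1 = w.1.1 -> u.1.2 = w.1.2 -> u.2 = v.2 -> u = v /\ v = w.

(** Parallelogram law: the squared distance from [a] to [b] is [2R + 2R - 4R = 0]. *)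
Lemma sphere_midpoint (k : nat) (a b c : 'I_k -> int) (R : int) :
  (forall j, a j + b j = 2 * c j) ->
  \sum_j a j ^+ 2 = R -> \sum_j b j ^+ 2 = R -> \sum_j c j ^+ 2 = R ->
  forall j, a j = b j.
Proof.
move=> abc sa sb sc.
have : \sum_j (a j - b j) ^+ 2 = 0.
  have -> : \sum_j (a j - b j) ^+ 2 = \sum_j (2 * a j ^+ 2 + 2 * b j ^+ 2 - 4 * c j ^+ 2).
    apply: eq_bigr => j _.
    have -> : 4 * c j ^+ 2 = (2 * c j) ^+ 2 :> int by ring.
    by rewrite -abc; ring.
  by rewrite sumrB big_split -!mulr_sumr /= sa sb sc; ring.
move/eqP; rewrite psumr_eq0 => [|j _]; last exact: sqr_ge0.
move=> /allP z j; have := z j (mem_index_enum j).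
by rewrite sqrf_eq0 subr_eq0 => /eqP.
Qed.

(* Behrend's construction: in the triples (x, y, x + y), a triangle gives a
   three-term progression of vectors x - y, so it is degenerate as soon as
   the vectors x - y all lie on one sphere. *)
Lemma triangle_free_exists (n k : nat) : (0 < n)%N ->
  exists S : {set {ffun 'I_k -> 'I_n} * {ffun 'I_k -> 'I_n} * {ffun 'I_k -> 'I_n}},
    triangle_free S /\ (n.+1./2 ^ (k * 2) <= (k * n ^ 2).+1 * #|S|)%N.
Proof.
case: n => // n _.
pose I := {ffun 'I_k -> 'I_n.+1}.
pose N (v : I * I * I) := absz (\sum_j ((v.1.1 j)%:Z - (v.1.2 j)%:Z) ^+ 2).
pose T := [set v : I * I * I | [forall j, v.2 j == (v.1.1 j + v.1.2 j)%N :> nat]].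
pose S R := [set v in T | N v == R].
have NZ v : (N v)%:Z = \sum_j ((v.1.1 j)%:Z - (v.1.2 j)%:Z) ^+ 2.
  by rewrite /N gez0_abs //; apply: sumr_ge0 => j _; exact: sqr_ge0.
have tri R : triangle_free (S R).
  move=> u v w; rewrite !in_set.
  move=> /andP[/forallP uT /eqP uN] /andP[/forallP vT /eqP vN].
  move=> /andP[/forallP wT /eqP wN].
  move=> vw uw uv.
  pose p j := (w.1.1 j)%:Z; pose q j := (w.1.2 j)%:Z; pose t j := (v.2 j)%:Z.
  have u1 j : (u.1.1 j)%:Z = t j - q j.
    by move/eqP: (uT j); rewrite /t /q uv uw => ->; rewrite PoszD addrK.
  have v2 j : (v.1.2 j)%:Z = t j - p j.
    by move/eqP: (vT j); rewrite /t /p -vw => ->; rewrite PoszD addrAC subrr add0r.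
  (* The vectors x - y of [u], [v], [w] are [t - 2q], [2p - t] and [p - q], and the last is the
     midpoint of the other two. *)
  have E := @sphere_midpoint k (fun j => t j - 2 * q j) (fun j => 2 * p j - t j)
    (fun j => p j - q j) R%:Z.
  have {}E j : t j = p j + q j.
    suff : t j - 2 * q j = 2 * p j - t j by lia.
    apply: E; first by move=> i; ring.
    - rewrite -uN NZ; apply: eq_bigr => i _; rewrite u1 uw; congr (_ ^+ 2).
      by rewrite /q; ring.
    - rewrite -vN NZ; apply: eq_bigr => i _; rewrite v2 vw; congr (_ ^+ 2).
      by rewrite /p; ring.
    - by rewrite -wN NZ.
  have vv : v.1.2 = w.1.2.
    by apply/ffunP => j; apply: val_inj; move: (v2 j); rewrite E addrAC subrr add0r => -[].
  have uu : u.1.1 = w.1.1.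
    by apply/ffunP => j; apply: val_inj; move: (u1 j); rewrite E addrK => -[].
  have tt : v.2 = w.2.
    apply/ffunP => j; apply: ord_inj; move: (E j) (wT j) => + /eqP ->.
    by rewrite /t /p /q -PoszD => -[].
  move: vw uw uv vv uu tt.
  by case: u v w {uT uN vT vN wT wN p q t u1 v2 E} => [[? ?] ?] [[? ?] ?] [[? ?] ?] /= -> -> -> -> -> ->.
have Nle v : (N v < (k * n.+1 ^ 2).+1)%N.
  rewrite ltnS -lez_nat NZ.
  have -> : (k * n.+1 ^ 2)%N%:Z = \sum_(j < k) (n.+1%:Z ^+ 2).
    by rewrite sumr_const card_ord -mulr_natl PoszM natz -rmorphXn.
  apply: ler_sum => j _; rewrite -subr_ge0 subr_sqr.
  have := ltn_ord (v.1.1 j); have := ltn_ord (v.1.2 j).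
  by move: (nat_of_ord _) (nat_of_ord _) => a b ? ?; apply: mulr_ge0; lia.
(* Two vectors with coordinates below [n.+2./2] have a sum with coordinates below [n.+1]. *)
have Tge : (n.+2./2 ^ (k * 2) <= #|T|)%N.
  pose h := n.+2./2; pose J := {ffun 'I_k -> 'I_h}.
  pose f (u : J * J) : I * I * I := ([ffun j => inord (u.1 j)], [ffun j => inord (u.2 j)],
     [ffun j => inord (u.1 j + u.2 j)]).
  have hn (a b : 'I_h) : (a + b < n.+1)%N by have := ltn_ord a; have := ltn_ord b; rewrite /h; lia.
  have hn1 (a : 'I_h) : (a < n.+1)%N by have := ltn_ord a; rewrite /h; lia.
  have -> : (n.+2./2 ^ (k * 2) = #|{: J * J}|)%N.
    by rewrite card_prod card_ffun !card_ord expnM mulnn.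
  have finj : injective f.
    move=> [x y] [x' y'] [/ffunP e1 /ffunP e2 _]; congr (_, _); apply/ffunP => j.
      by have := e1 j; rewrite !ffunE => /(congr1 val); rewrite /= !inordK // => /val_inj.
    by have := e2 j; rewrite !ffunE => /(congr1 val); rewrite /= !inordK // => /val_inj.
  rewrite -(card_codom finj); apply/subset_leq_card/subsetP => _ /codomP[u ->].
  by rewrite inE; apply/forallP => j; rewrite !ffunE !inordK.
(* Pigeonhole over the [(k * n.+1 ^ 2).+1] possible squared norms. *)
have [R RP] : exists R : 'I_(k * n.+1 ^ 2).+1, (#|T| <= (k * n.+1 ^ 2).+1 * #|S R|)%N.
  apply/existsP; apply: contraT; rewrite negb_exists => /forallP no.
  have : (\sum_(R < (k * n.+1 ^ 2).+1) (k * n.+1 ^ 2).+1 * #|S R| < \sum_(R < (k * n.+1 ^ 2).+1) #|T|)%N.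
    rewrite [X in (_ < X)%N](bigD1 ord0) //= (bigD1 ord0) //= -addSn leq_add //.
      by have := no ord0; rewrite -ltnNge.
    by apply: leq_sum => R _; have := no R; rewrite -ltnNge => /ltnW.
  rewrite -big_distrr sum_nat_const card_ord /= ltn_mul2l /= ltnNge => /negP[].
  rewrite -sum1_card (partition_big (fun v => Ordinal (Nle v)) predT) //=.
  apply: leq_sum => R _; rewrite -sum1_card; apply/eq_leq/eq_bigl => v.
  by rewrite [in RHS]inE.
exists (S R); split; first exact: tri.
exact: leq_trans Tge RP.
Qed.

(** * Double product families, their powers, and digits *)

(** The index type is arbitrary because the powers of a family are indexed by words. *)
Definition sdpp (G : zmodType) (I : Type) (A B : I -> pred G) : Prop :=
  (forall i a a' b b', A i a -> A i a' -> B i b -> B i b' ->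
     a - a' = b - b' -> a = a' /\ b = b') /\
  (forall i j l a a' b b', A i a -> A j a' -> B j b -> B l b' ->
     a - a' + b - b' = 0 -> i = l).

(** The inverse of [psi] on its image is a Freiman homomorphism of order 2; taking [b = d] shows
    that [psi] is injective. Only this direction matters, since equations between integers are to be
    pulled back to [G]. *)
Definition freiman2 (G : zmodType) (psi : G -> nat) : Prop :=
  forall a b c d, (psi a + psi b = psi c + psi d)%N -> a + b = c + d.

Lemma base_digits_inj (W k : nat) (x y : 'I_k -> nat) :
  (forall j, x j < W)%N -> (forall j, y j < W)%N ->
  (\sum_j x j * W ^ j = \sum_j y j * W ^ j)%N -> x =1 y.
Proof.
elim: k x y => [|k IH] x y lx ly; first by move=> _ [].
have E z : (\sum_(j < k.+1) z j * W ^ j = (\sum_(j < k) z (lift ord0 j) * W ^ j) * W + z ord0)%N.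
  rewrite big_ord_recl expn0 muln1 addnC big_distrl /=; congr addn.
  by apply: eq_bigr => j _; rewrite -[bump 0 j]/(j.+1) expnSr mulnA.
have W0 : (0 < W)%N by apply: leq_ltn_trans (lx ord0).
rewrite !E => e.
have e0 : x ord0 = y ord0 by have := congr1 (modn^~ W) e; rewrite !modnMDl !modn_small.
move/(congr1 (divn^~ W)): e; rewrite !divnMDl // !divn_small // !addn0 => /IH e j.
by case: (unliftP ord0 j) => [i|] ->; rewrite ?e.
Qed.

Lemma base_digits_lt (W k : nat) (x : 'I_k -> nat) :
  (forall j, x j < W)%N -> (\sum_j x j * W ^ j < W ^ k)%N.
Proof.
elim: k x => [|k IH] x lx; first by rewrite big_ord0.
rewrite big_ord_recr /= expnS.
have := IH _ (fun j => lx (widen_ord (leqnSn k) j)); have := lx ord_max.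
rewrite /=; move: (bigop _ _ _) (x _) (W ^ k)%N => s y w; nia.
Qed.

(** In base [2 * L] a sum of two values of [psi] is still a single digit, so equal sums agree in
    each coordinate. *)
Lemma freiman2_ffun (G : zmodType) (k L : nat) (psi : G -> nat) :
  freiman2 psi -> (forall g, psi g < L)%N ->
  exists Psi : {ffun 'I_k -> G} -> nat,
    freiman2 Psi /\ forall g, (Psi g < (2 * L) ^ k)%N.
Proof.
move=> fr psiL.
have psi2 x y : (psi x + psi y < 2 * L)%N by have := psiL x; have := psiL y; lia.
exists (fun g : {ffun 'I_k -> G} => \sum_j psi (g j) * (2 * L) ^ j)%N; split; last first.
  by move=> g; apply: base_digits_lt => j; have := psiL (g j); lia.
move=> a b c d; rewrite -!big_split /= => e; apply/ffunP => j; rewrite !ffunE.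
apply: fr; move: j; apply: (@base_digits_inj (2 * L)).
- by move=> j /=; exact: psi2.
- by move=> j /=; exact: psi2.
- rewrite [LHS](eq_bigr (fun i => psi (a i) * (2 * L) ^ i + psi (b i) * (2 * L) ^ i)%N).
    by rewrite e; apply: eq_bigr => i _; rewrite mulnDl.
  by move=> i _; rewrite mulnDl.
Qed.

Lemma base3_inj (W x0 x1 x2 y0 y1 y2 : nat) :
  (x0 < W -> x1 < W -> y0 < W -> y1 < W ->
   x0 + W * x1 + W ^ 2 * x2 = y0 + W * y1 + W ^ 2 * y2 ->
   [/\ x0 = y0, x1 = y1 & x2 = y2])%N.
Proof.
move=> lx0 lx1 ly0 ly1.
have E u v w : (u + W * v + W ^ 2 * w = (w * W + v) * W + u)%N by ring.
rewrite !E => e.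
have W0 : (0 < W)%N by apply: leq_ltn_trans lx0.
have e0 : x0 = y0 by have := congr1 (modn^~ W) e; rewrite !modnMDl !modn_small.
have e1 : (x2 * W + x1 = y2 * W + y1)%N.
  by have := congr1 (divn^~ W) e; rewrite !divnMDl // !divn_small // !addn0.
have e2 : x1 = y1 by have := congr1 (modn^~ W) e1; rewrite !modnMDl !modn_small.
by have := congr1 (divn^~ W) e1; rewrite !divnMDl // !divn_small // !addn0.
Qed.

Lemma base3_lt (W x0 x1 x2 : nat) :
  (x0 < W -> x1 < W -> x2 < W -> x0 + W * x1 + W ^ 2 * x2 < W ^ 3)%N.
Proof. nia. Qed.

Lemma sdpp_disjoint (G : zmodType) (I : Type) (A B : I -> pred G) i j a b :
  sdpp A B -> A i a -> A j a -> B j b -> i = j.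
Proof. by case=> _ H Aia Aja Bjb; apply: (H i j j a a b b); rewrite ?subrr ?add0r ?subrr. Qed.

(* For v in S, the blocks are A_{v1} x B_{v3}, B_{v1} x A_{v2} and
   B_{v2} x A_{v3}, written in base W as al - be, be - ga, ga - al, as in
   Cohn-Kleinberg-Szegedy-Umans; the i-th digit of a vanishing sum equates one
   coordinate of two of the three triples v, and S is triangle-free. *)
Lemma trapezoid_val_sdpp (G : finZmodType) (I : finType) (A B : I -> {set G})
    (S : {set I * I * I}) (psi : G -> nat) (L N : nat) :
  sdpp (fun i => mem (A i)) (fun i => mem (B i)) -> triangle_free S ->
  freiman2 psi -> (forall g, psi g < L)%N -> ((2 * L) ^ 3 <= N.+1)%N ->
  (\sum_(v in S) ((#|A v.1.1| * #|B v.1.1|) * (#|A v.1.2| * #|B v.1.2|) * (#|A v.2| * #|B v.2|))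
    <= trapezoid_val 'I_N.+1)%N.
Proof.
move=> sd tri fr psiL LN; pose W := (2 * L)%N.
have psi2 x y : (psi x + psi y < W)%N by have := psiL x; have := psiL y; rewrite /W; lia.
have [sd1 sd2] := sd.
pose V := (I * I * I)%type; pose T := (V * (G * G))%type.
pose P := [set p : T | [&& p.1 \in S, p.2.1 \in A p.1.1.1 & p.2.2 \in B p.1.2]].
pose Q := [set p : T | [&& p.1 \in S, p.2.1 \in B p.1.1.1 & p.2.2 \in A p.1.1.2]].
pose R := [set p : T | [&& p.1 \in S, p.2.1 \in B p.1.1.2 & p.2.2 \in A p.1.2]].
pose al (p : T) : 'I_N.+1 := inZp (psi p.2.1 + W * 0 + W ^ 2 * psi p.2.2).
pose be (p : T) : 'I_N.+1 := inZp (psi p.2.1 + W * psi p.2.2 + W ^ 2 * 0).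
pose ga (p : T) : 'I_N.+1 := inZp (0 + W * psi p.2.1 + W ^ 2 * psi p.2.2).
have fr0 a b c d : (psi a + psi b = psi c + psi d)%N -> a - c + b - d = 0.
  by move/fr => e; rewrite [a - c + b]addrAC e [c + d - c]addrAC addrN add0r subrr.
have inZpD x y : inZp (x + y) = inZp x + inZp y :> 'I_N.+1.
  by apply: val_inj; rewrite /= modnDm.
have stpp p p' q q' r r' : p \in P -> p' \in P -> q \in Q -> q' \in Q ->
     r \in R -> r' \in R -> p.1 = q.1 -> q'.1 = r.1 -> r'.1 = p'.1 ->
     (al p - be q) + (be q' - ga r) + (ga r' - al p') = 0 ->
     [/\ p = p', q = q' & r = r'].
  case: p p' q q' r r' => [v [a1 b3]] [w [a1' b3']] [v0 [b1 a2]] [u [b1' a2']] [u0 [b2 a3]] [w0 [b2' a3']].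
  rewrite !inE /= => /and3P[vS a1A b3B] /and3P[wS a1A' b3B'] /and3P[_ b1B a2A] /and3P[uS b1B' a2A'].
  move=> /and3P[_ b2B a3A] /and3P[_ b2B' a3A'] e1 e2 e3; subst v0 u0 w0.
  move=> e.
  (* Moving the negative terms across leaves sums of natural numbers below [N.+1], so that the
     equation modulo [N.+1] becomes an equality of integers. *)
  have {e} : al (v, (a1, b3)) + be (u, (b1', a2')) + ga (w, (b2', a3')) =
      al (w, (a1', b3')) + be (v, (b1, a2)) + ga (u, (b2, a3)).
    move: e; rewrite (addrACA (al _)) -opprD addrACA -opprD => /subr0_eq ->.
    by rewrite addrC addrA.
  rewrite /al /be /ga -!inZpD /= => /(congr1 val) /=.
  have E x y z x' y' z' : (psi x + W * 0 + W ^ 2 * psi y + (psi x' + W * psi y' + W ^ 2 * 0) +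
      (0 + W * psi z + W ^ 2 * psi z') = (psi x + psi x') + W * (psi y' + psi z) + W ^ 2 * (psi y + psi z'))%N.
    by ring.
  have lt6 x y z x' y' z' : ((psi x + psi x') + W * (psi y' + psi z) + W ^ 2 * (psi y + psi z') < N.+1)%N.
    exact: leq_trans (base3_lt (psi2 _ _) (psi2 _ _) (psi2 _ _)) LN.
  rewrite !E modn_small ?lt6 // modn_small ?lt6 //.
  move=> /base3_inj[||||c1 c2 c3].
  1-4: exact: psi2.
  have uw1 : u.1.1 = w.1.1.
    by apply/esym/(sd2 _ v.1.1 _ a1' a1 b1 b1') => //; apply: fr0; rewrite -c1.
  have vw2 : v.1.2 = w.1.2.
    apply: (sd2 _ u.1.2 _ a2 a2' b2 b2') => //; exact: fr0 (esym c2).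
  have uv3 : v.2 = u.2.
    apply/esym/(sd2 _ w.2 _ a3 a3' b3' b3) => //; by apply: fr0; rewrite addnC -c3 addnC.
  have [uw vw] := tri v u w vS uS wS uw1 vw2 uv3.
  (* Once the three index triples coincide, each digit equation is an instance of the first part of
     the double product property. *)
  subst u w; have {}fr0 a b c d : (psi a + psi b = psi c + psi d)%N -> a - c = d - b.
    by move/fr0/eqP; rewrite -addrA addr_eq0 opprB => /eqP.
  have c3' : (psi a3 + psi b3' = psi a3' + psi b3)%N by rewrite addnC -c3 addnC.
  have [-> ->] := sd1 _ a1 a1' b1 b1' a1A a1A' b1B b1B' (fr0 _ _ _ _ c1).
  have [-> ->] := sd1 _ a2' a2 b2 b2' a2A' a2A b2B b2B' (fr0 _ _ _ _ c2).
  have [-> ->] := sd1 _ a3 a3' b3 b3' a3A a3A' b3B b3B' (fr0 _ _ _ _ c3').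
  by [].
apply: leq_trans (@trapezoid_val_ge _ V T T T fst fst fst P Q R al be ga stpp).
pose F (v : V) := setX (setX (setX (A v.1.1) (B v.2)) (setX (B v.1.1) (A v.1.2)))
   (setX (B v.1.2) (A v.2)).
pose f (x : V * (((G * G) * (G * G)) * (G * G))) : T * T * T :=
  ((x.1, x.2.1.1), (x.1, x.2.1.2), (x.1, x.2.2)).
have finj : injective f by move=> [v [[x y] z]] [v' [[x' y'] z']] [-> -> _ -> _ ->].
have -> : (\sum_(v in S) ((#|A v.1.1| * #|B v.1.1|) * (#|A v.1.2| * #|B v.1.2|) * (#|A v.2| * #|B v.2|)) =
   #|[set x : V * (((G * G) * (G * G)) * (G * G)) | (x.1 \in S) && (x.2 \in F x.1)]|)%N.
  rewrite [LHS](eq_bigr (fun v => \sum_(x in F v) 1)%N) => [|v _].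
    by rewrite pair_big_dep -sum1_card; apply: eq_bigl => x; rewrite [RHS]inE.
  by rewrite sum1_card !cardsX; ring.
rewrite -(card_imset _ finj); apply/subset_leq_card/subsetP => y.
case/imsetP => -[v [[[a1 b3] [b1 a2]] [b2 a3]]]; rewrite !inE /=.
case/and3P => vS /andP[/andP[h1 h2] /andP[h3 h4]] /andP[h5 h6] ->.
by rewrite /= vS h1 h2 h3 h4 h5 h6 !eqxx.
Qed.

(* A name for the type of finite functions, which has no finZmodType instance. *)
Definition power_group (k : nat) (G : finZmodType) := {ffun 'I_k -> G}.
HB.instance Definition _ k G := Finite.on (power_group k G).
HB.instance Definition _ k G := GRing.Zmodule.on (power_group k G).

(** Products of the sets along words of length [k] again form a double product family, in the [k]-th
    power of [G]. Each triple of words in a triangle-free family contributes at least [mu ^ (k * 3)]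
    solutions. *)
Lemma trapezoid_val_sdpp_power (G : finZmodType) (n : nat) (A B : 'I_n -> {set G})
    (psi : G -> nat) (L N k mu : nat) :
  (0 < n)%N -> sdpp (fun i => mem (A i)) (fun i => mem (B i)) ->
  freiman2 psi -> (forall g, psi g < L)%N ->
  (forall i, mu <= #|A i| * #|B i|)%N ->
  ((2 * (2 * L) ^ k) ^ 3 <= N.+1)%N ->
  (n.+1./2 ^ (k * 2) * mu ^ (k * 3) <= (k * n ^ 2).+1 * trapezoid_val 'I_N.+1)%N.
Proof.
move=> n0 [sd1 sd2] fr psiL muAB LN.
have [Psi [Psi_fr Psi_lt]] := freiman2_ffun k fr psiL.
have [S [tri Sge]] := triangle_free_exists k n0.
pose Pw (C : 'I_n -> {set G}) (f : {ffun 'I_k -> 'I_n}) :=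
  [set g : {ffun 'I_k -> G} | g \in family (fun j => mem (C (f j)))].
have PwE C f g j : mem (Pw C f) g -> mem (C (f j)) (g j).
  by rewrite /= inE => /familyP/(_ j).
have cPw C f : #|Pw C f| = (\prod_j #|C (f j)|)%N.
  by rewrite cardsE card_family foldrE big_image.
have sdP : sdpp (fun f => mem (Pw A f)) (fun f => mem (Pw B f)).
  split.
    move=> f a a' b b' aA aA' bB bB' /ffunP e.
    have E j : a j = a' j /\ b j = b' j.
      apply: (sd1 (f j)); try exact: PwE.
      by have := e j; rewrite !ffunE.
    by split; apply/ffunP => j; case: (E j).
  move=> f g h a a' b b' aA aA' bB bB' /ffunP e; apply/ffunP => j.
  apply: (sd2 _ (g j) _ (a j) (a' j) (b j) (b' j)); try exact: PwE.
  by have := e j; rewrite !ffunE.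
have := @trapezoid_val_sdpp (power_group k G) _ (Pw A) (Pw B) S Psi _ N sdP tri Psi_fr Psi_lt LN.
have Pmu f : (mu ^ k <= #|Pw A f| * #|Pw B f|)%N.
  rewrite !cPw -big_split /= -[X in (_ ^ X <= _)%N]card_ord -prod_nat_const.
  exact: leq_prod.
move=> le; apply: leq_trans (leq_mul Sge (leqnn _)) _.
rewrite -mulnA leq_mul2l /=; apply: leq_trans le.
rewrite -sum_nat_const; apply: leq_sum => v _.
by rewrite expnM !expnS expn0 muln1 mulnA !leq_mul.
Qed.

(* Elements of <H, x> are h + c x with 0 <= c < m; doubling the range allowed
   for each digit keeps sums of two elements free of carries. *)
Lemma freiman2_adjoin (G : finZmodType) (H : {group G}) (x : G) (psi : G -> nat) (L : nat) :
  (forall a b c d, a \in H -> b \in H -> c \in H -> d \in H ->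
     (psi a + psi b = psi c + psi d)%N -> a + b = c + d) ->
  (forall a, a \in H -> psi a < L)%N ->
  let K := (H <*> <[x]>)%G in
  exists psi' : G -> nat, exists m : nat,
    [/\ (m * #|H| <= #|K|)%N,
      (forall a b c d, a \in K -> b \in K -> c \in K -> d \in K ->
        (psi' a + psi' b = psi' c + psi' d)%N -> a + b = c + d) &
      (forall a, a \in K -> psi' a < 2 * m * L)%N].
Proof.
move=> fr psiL K.
have xK : x \in K by rewrite mem_gen // inE cycle_id orbT.
have sHK : H \subset K by exact: joing_subl.
have exm : exists m, (0 < m)%N && (x *+ m \in H).
  by exists #[x]%g; rewrite order_gt0 -FinRing.zmodXgE expg_order group1.
(* [m] is the order of [x] modulo [H]. *)
case: (ex_minnP exm) => m /andP[m0 mH] mmin.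
(* The implication makes the existence hold for every [g], so that the digit [c] is a total function
   on [G]. *)
have exc g : exists c, (g \in K) ==> (c < m)%N && (g - x *+ c \in H).
  case: (boolP (g \in K)) => [|_]; last by exists 0%N.
  rewrite /= cent_joinEr ?(sub_abelian_cent2 (FinRing.zmod_abelian [set: G])) ?subsetT //.
  case/mulsgP => h _ hH /cycleP[i ->] ->; exists (i %% m)%N.
  rewrite ltn_mod m0 /= FinRing.zmodMgE FinRing.zmodXgE -addrA.
  rewrite {1}(divn_eq i m) mulrnDr addrK mulnC mulrnA.
  exact: (groupM hH (groupX _ mH)).
pose c g := xchoose (exc g).
have cP g : g \in K -> (c g < m)%N /\ g - x *+ c g \in H.
  by move=> gK; have /implyP/(_ gK)/andP := xchooseP (exc g).
pose W := (2 * L)%N.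
exists (fun g : G => psi (g - x *+ c g)%R + W * c g)%N, m; split.
- pose f (u : 'I_m * G) : G := u.2 + x *+ u.1.
  have finj : {in setX [set: 'I_m] H &, injective f}.
    have aux (i j : nat) h h' : (i <= j < m)%N -> h \in H -> h' \in H ->
        h + x *+ i = h' + x *+ j -> i = j.
      move=> /andP[ij jm] hH h'H e; apply/eqP; rewrite eqn_leq ij -subn_eq0 /=.
      apply: contraT; rewrite -lt0n => ji.
      suff : (m <= j - i)%N by lia.
      apply: mmin; rewrite ji mulrnBr //=.
      have -> : x *+ j - x *+ i = h - h'.
        by apply/eqP; rewrite subr_eq addrAC eq_sym subr_eq e addrC.
      exact: (groupM hH (groupVr h'H)).
    move=> [i h] [j h']; rewrite !inE /= => hH h'H e.
    have ij : i = j.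
      apply: ord_inj; case: (leqP i j) => [ij | /ltnW ji].
        by apply: (aux i j h h') => //; rewrite ij ltn_ord.
      by apply/esym/(aux j i h' h) => //; rewrite ji ltn_ord.
    by move: e; rewrite /f /= ij => /addIr ->.
  have -> : (m * #|H| = #|setX [set: 'I_m] H|)%N by rewrite cardsX cardsT card_ord.
  rewrite -(card_in_imset finj); apply/subset_leq_card/subsetP => y.
  case/imsetP => -[i h]; rewrite !inE /= => hH ->.
  exact: (groupM (subsetP sHK _ hH) (groupX _ xK)).
- move=> g1 g2 g3 g4 /cP[l1 H1] /cP[l2 H2] /cP[l3 H3] /cP[l4 H4] /= e.
  have := psiL _ H1; have := psiL _ H2; have := psiL _ H3; have := psiL _ H4.
  move: e (fr _ _ _ _ H1 H2 H3 H4).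
  move: (psi (g1 - _)) (psi (g2 - _)) (psi (g3 - _)) (psi (g4 - _)) => p1 p2 p3 p4.
  move: (c g1) (c g2) (c g3) (c g4) => c1 c2 c3 c4 e fr' lt4 lt3 lt2 lt1.
  have e2 : ((c1 + c2) * W + (p1 + p2) = (c3 + c4) * W + (p3 + p4))%N.
    by move: e; rewrite !mulnDl ![(_ * W)%N]mulnC; lia.
  have L0 : (0 < W)%N by rewrite /W; lia.
  have ep : (p1 + p2 = p3 + p4)%N.
    by have := congr1 (modn^~ W) e2; rewrite !modnMDl !modn_small // /W; lia.
  have ec : (c1 + c2 = c3 + c4)%N.
    by move: e2; rewrite ep => /addIn/eqP; rewrite eqn_pmul2r // => /eqP.
  move/fr': ep; rewrite addrACA [RHS]addrACA -!opprD -!mulrnDr ec.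
  by move/addIr.
- move=> a /cP[l1 /psiL l2] /=; nia.
Qed.

(** Generators are adjoined one at a time: each doubles the bound, while [m * #|H| <= #|K|] keeps
    the other factor within the order of the group. *)
Lemma freiman2_generated (G : finZmodType) (s : seq G) :
  exists psi : G -> nat,
    (forall a b c d, a \in <<[set:: s]>>%g -> b \in <<[set:: s]>>%g ->
       c \in <<[set:: s]>>%g -> d \in <<[set:: s]>>%g ->
       (psi a + psi b = psi c + psi d)%N -> a + b = c + d) /\
    (forall a, a \in <<[set:: s]>>%g -> psi a < 2 ^ size s * #|<<[set:: s]>>%g|)%N.
Proof.
elim: s => [|x s [psi [fr psiL]]].
  exists (fun=> 0%N); rewrite set_nil gen0; split.
    by move=> a b c d /set1P-> /set1P-> /set1P-> /set1P->.
  by move=> a _; rewrite cards1.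
have [psi' [m [le fr' lt']]] := freiman2_adjoin x fr psiL.
have E : (<<[set:: x :: s]>> = <<[set:: s]>> <*> <[x]>)%g.
  by rewrite set_cons setUC joing_idl joing_idr.
exists psi'; rewrite E; split=> // a /lt' /leq_trans; apply.
rewrite [leqLHS](_ : _ = 2 ^ size (x :: s) * (m * #|<<[set:: s]>>%g|))%N ?leq_mul //.
by rewrite /= expnS; ring.
Qed.

(** A finite abelian group is generated by as many elements as its rank. *)
Lemma freiman2_exists (G : finZmodType) :
  exists psi : G -> nat,
    freiman2 psi /\ forall g, (psi g < 2 ^ 'r([set: G])%g * #|G|)%N.
Proof.
rewrite -(grank_abelian (FinRing.zmod_abelian [set: G])).
have [B BG Bm] := grank_witness [set: G].
have [psi [fr lt]] := freiman2_generated (enum B).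
move: fr lt; rewrite set_enum BG -cardE Bm cardsT => fr lt.
by exists psi; split=> [a b c d|g]; [apply: fr | apply: lt]; rewrite inE.
Qed.

(** * Slice rank of the addition table *)

Definition monomial4 (R : comNzRingType) (x y z t : R) (q : nat * nat * nat * nat) : R :=
  x ^+ q.1.1.1 * y ^+ q.1.1.2 * z ^+ q.1.2 * t ^+ q.2.

(** Monomials are listed with repetition, which replaces the multinomial coefficients. The variable
    [t] is left out of the degree bound because it will be a constant. *)
Lemma exprD4_monomials (R : comNzRingType) (n : nat) :
  exists s : seq (nat * nat * nat * nat),
    (forall q, q \in s -> q.1.1.1 + q.1.1.2 + q.1.2 <= n)%N /\
    forall x y z t : R, (x + y + z + t) ^+ n = \sum_(q <- s) monomial4 x y z t q.
Proof.
elim: n => [|n [s [sle sE]]].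
  exists [:: (0, 0, 0, 0)%N]; split; first by move=> q; rewrite inE => /eqP ->.
  by move=> x y z t; rewrite big_seq1 /monomial4 !expr0 !mulr1.
exists ([seq (q.1.1.1.+1, q.1.1.2, q.1.2, q.2) | q <- s] ++
  [seq (q.1.1.1, q.1.1.2.+1, q.1.2, q.2) | q <- s] ++
  [seq (q.1.1.1, q.1.1.2, q.1.2.+1, q.2) | q <- s] ++
  [seq (q.1.1.1, q.1.1.2, q.1.2, q.2.+1) | q <- s]); split.
  move=> q; rewrite !mem_cat => /or4P[] /mapP[[[[a b] c] d] /sle /= le ->] /=; lia.
move=> x y z t; rewrite exprS sE !big_cat !big_map /= !mulrDl !mulr_sumr !addrA.
by do ![congr (_ + _)]; apply: eq_bigr => q _; rewrite /monomial4 /= exprS; ring.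
Qed.

(** Fermat's little theorem, read in the prime subfield of [F]. *)
Lemma pchar_indicator (F : fieldType) (p k : nat) : p \in [pchar F] ->
  1 - (k%:R : F) ^+ p.-1 = (p %| k)%:R.
Proof.
move=> pF; have p_pr := pcharf_prime pF.
case: (boolP (p %| k)%N) => [|]; rewrite (dvdn_pcharf pF).
  by move/eqP => ->; rewrite expr0n eqn0Ngt -subn1 subn_gt0 prime_gt1 // subr0.
move=> k0; apply/eqP; rewrite subr_eq0 eq_sym; apply/eqP/(mulfI k0).
by rewrite -exprS prednK ?prime_gt0 // mulr1 -(pFrobenius_autE pF) pFrobenius_aut_nat.
Qed.

(** The dual form of a slice decomposition: [u x] lists the digits of [x], and [f] is orthogonal to
    the monomials of degree at most [r(p - 1)/3] in them. *)
Definition low_moments_vanish (F : fieldType) (p r : nat) (X : finType)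
    (u : X -> 'I_r -> nat) (f : X -> F) :=
  forall m : 'I_r -> nat, (forall i, m i < p)%N -> (3 * \sum_i m i <= r * p.-1)%N ->
    \sum_x f x * \prod_i (u x i)%:R ^+ m i = 0.

(* Croot-Lev-Pach: the product over i of 1 - (x + y + z + t)^(p - 1) has total
   degree r (p - 1), so each of its monomials has degree at most r (p - 1) / 3
   in one of the three groups of variables. *)
Lemma trilinear_vanish (F : fieldType) (p r : nat) (X Y Z : finType)
    (u : X -> 'I_r -> nat) (v : Y -> 'I_r -> nat) (w : Z -> 'I_r -> nat) (k : 'I_r -> nat)
    (f : X -> F) (g : Y -> F) (h : Z -> F) :
  p \in [pchar F] ->
  low_moments_vanish p u f -> low_moments_vanish p v g -> low_moments_vanish p w h ->
  \sum_x \sum_y \sum_(z | [forall i, p %| u x i + v y i + w z i + k i]%N)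
    f x * g y * h z = 0.
Proof.
move=> pF uf vg wh; have p_pr := pcharf_prime pF; have p0 := prime_gt0 p_pr.
have [s [sle sE]] := exprD4_monomials F p.-1.
(* The index [ord0] stands for the constant 1, the others for the monomials of the power that is
   subtracted from it. *)
pose J := 'I_(size s).+1.
pose ex (j : J) : nat * nat * nat * nat := nth (0, 0, 0, 0)%N ((0, 0, 0, 0)%N :: s) j.
pose co (j : J) : F := if j == ord0 then 1 else -1.
have exle j : ((ex j).1.1.1 + (ex j).1.1.2 + (ex j).1.2 <= p.-1)%N.
  rewrite /ex; case: (unliftP ord0 j) => [i|] -> //=.
  by apply: sle; apply: mem_nth; exact: ltn_ord.
have ind x y z t : ((p %| x + y + z + t)%N)%:R =
    \sum_(j : J) co j * monomial4 x%:R y%:R z%:R t%:R (ex j) :> F.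
  rewrite -(pchar_indicator _ pF) !natrD sE big_ord_recl; congr (_ + _).
    by rewrite /co eqxx /ex /monomial4 /= !expr0 !mulr1.
  rewrite (big_nth (0, 0, 0, 0)%N) big_mkord -sumrN; apply: eq_bigr => j _.
  by rewrite /co /ex /= mulN1r.
pose J' := {ffun 'I_r -> J}.
pose PX (m : J') x := \prod_i (u x i)%:R ^+ (ex (m i)).1.1.1 : F.
pose PY (m : J') y := \prod_i (v y i)%:R ^+ (ex (m i)).1.1.2 : F.
pose PZ (m : J') z := \prod_i (w z i)%:R ^+ (ex (m i)).1.2 : F.
pose K (m : J') := \prod_i (co (m i) * (k i)%:R ^+ (ex (m i)).2) : F.
have indE x y z : ([forall i, p %| u x i + v y i + w z i + k i]%N)%:R =
    \sum_(m : J') K m * (PX m x * PY m y * PZ m z) :> F.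
  transitivity (\prod_i ((p %| u x i + v y i + w z i + k i)%N)%:R : F).
    case: (boolP [forall i, _]) => [/forallP all1 | ].
      by rewrite big1 // => i _; rewrite all1.
    rewrite negb_forall => /existsP[i /negPf ni].
    by rewrite (bigD1 i) //= ni mul0r.
  under eq_bigr => i _ do rewrite ind.
  rewrite bigA_distr_bigA; apply: eq_bigr => m _.
  rewrite -!big_split /=; apply: eq_bigr => i _; rewrite /monomial4; ring.
transitivity (\sum_(m : J') K m * ((\sum_x f x * PX m x) * (\sum_y g y * PY m y) *
    (\sum_z h z * PZ m z))).
  transitivity (\sum_x \sum_y \sum_z \sum_(m : J')
      K m * ((f x * PX m x) * (g y * PY m y) * (h z * PZ m z))).
    apply: eq_bigr => x _; apply: eq_bigr => y _; rewrite big_mkcond.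
    apply: eq_bigr => z _; rewrite -mulrb -mulr_natr indE mulr_sumr.
    by apply: eq_bigr => m _; ring.
  under eq_bigr => x _ do (under eq_bigr => y _ do rewrite exchange_big; rewrite exchange_big).
  rewrite exchange_big; apply: eq_bigr => m _.
  rewrite /= big_distrlr /= [in RHS]big_distrl /= [in RHS]big_distrr; apply: eq_bigr => x _.
  rewrite [in RHS]big_distrl /= [in RHS]big_distrr; apply: eq_bigr => y _.
  by rewrite [in RHS]big_distrr /= [in RHS]big_distrr.
apply: big1 => m _.
have : (\sum_i (ex (m i)).1.1.1 + \sum_i (ex (m i)).1.1.2 + \sum_i (ex (m i)).1.2 <= r * p.-1)%N.
  rewrite -!big_split /= -[r in (_ <= r * _)%N]card_ord -sum_nat_const.
  exact: leq_sum.
have lt i : [/\ (ex (m i)).1.1.1 < p, (ex (m i)).1.1.2 < p & (ex (m i)).1.2 < p]%N.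
  by have := exle (m i); split; lia.
have small (a b c n : nat) : (a + b + c <= n)%N -> [\/ 3 * a <= n, 3 * b <= n | 3 * c <= n]%N.
  move=> le; case: (leqP (3 * a) n) => [|ha]; first by constructor 1.
  by case: (leqP (3 * b) n) => [|hb]; [constructor 2 | constructor 3; lia].
case/small => le.
- rewrite (_ : \sum_x _ = 0) ?mul0r ?mulr0 //.
  by apply: (uf (fun i => (ex (m i)).1.1.1)) => // i; case: (lt i).
- rewrite (_ : \sum_y g y * _ = 0) ?mul0r ?mulr0 ?mul0r ?mulr0 //.
  by apply: (vg (fun i => (ex (m i)).1.1.2)) => // i; case: (lt i).
- rewrite (_ : \sum_z h z * _ = 0) ?mulr0 //.
  by apply: (wh (fun i => (ex (m i)).1.2)) => // i; case: (lt i).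
Qed.

(* AM-GM for D - d twos and d ones; equivalently 2^(-d/D) <= 1 - d/(2D), which
   serves as the exponential weight of a Chernoff bound without real powers. *)
Lemma agm_weight (D d : nat) : (d <= D -> (2 * D) ^ D <= (2 * D - d) ^ D * 2 ^ d)%N.
Proof.
move=> dD; have := @leif_AGM_scaled int 'I_D predT (fun i => if (i < d)%N then 1 else 2).
rewrite cardT size_enum_ord => /(_ _)[].
  by move=> i _; apply: mulrn_wge0; case: ifP.
have sumE : \sum_(i : 'I_D) (if (i < d)%N then 1 else 2) = (2 * D - d)%N%:Z.
  have : \sum_(i : 'I_D) (if (i < d)%N then 1 else 2) + \sum_(i < D) (i < d)%:R = (2 * D)%N%:Z.
    rewrite -big_split /= (eq_bigr (fun=> 2)) => [|i _]; last by case: ifP.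
    by rewrite sumr_const card_ord -[2 *+ D]mulr_natr PoszM (natz D).
  have -> : \sum_(i < D) (i < d)%:R = d%:Z :> int.
    rewrite -natr_sum natz; congr Posz.
    rewrite -(subnKC dD) big_split_ord /=.
    by rewrite (eq_bigr (fun=> 1%N)) => [|i _]; rewrite ?ltn_ord // sum_nat_const card_ord
      muln1 big1 ?addn0 // => i _; rewrite ltnNge leq_addr.
  by move=> e; apply/eqP; rewrite -subr_eq0; apply/eqP; lia.
have prodE : \prod_(i : 'I_D) ((if (i < d)%N then 1 else 2) *+ D) = (D ^ D * 2 ^ (D - d))%N%:Z.
  rewrite (eq_bigr (fun i : 'I_D => ((if (i < d)%N then 1 else 2) * D)%N%:Z)) => [|i _]; last first.
    by rewrite PoszM -[_ *+ D]mulr_natr (natz D); case: ifP.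
  rewrite -(big_morph Posz PoszM (erefl _)); congr Posz.
  rewrite big_split /= prod_nat_const card_ord mulnC; congr muln.
  rewrite -(big_mkord predT (fun i => if (i < d)%N then 1 else 2)%N).
  rewrite (big_cat_nat (leq0n d) dD) /= big1_seq ?mul1n => [|i]; last first.
    by rewrite mem_index_iota => /andP[_ /andP[_ ->]].
  rewrite big_nat_cond (eq_bigr (fun=> 2%N)) => [|i /andP[/andP[di _] _]]; last first.
    by rewrite ltnNge di.
  by rewrite -big_nat_cond prod_nat_const_nat.
rewrite sumE prodE -natz -[X in _ <= X ^+ _]natz -natrX ler_nat => le _.
have -> : ((2 * D) ^ D = (D ^ D * 2 ^ (D - d)) * 2 ^ d)%N.
  by rewrite expnMn -mulnA -expnD subnK // mulnC.
by rewrite leq_mul2r le orbT.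
Qed.

Definition low_degrees (p r : nat) : {set {ffun 'I_r -> 'I_p}} :=
  [set m : {ffun 'I_r -> 'I_p} | (3 * \sum_i m i <= r * p.-1)%N].

(** A Chernoff bound with [D = p - 1]: the weight, the product of the [2D - m i], averages
    [(3/4)^r (2D)^r], while by [agm_weight] its cube is at least [(2D)^(3r) / 2^r] on low degrees.
    The cube of the density is therefore at most [(27/64)^r 2^r = (27/32)^r]. *)
Lemma card_low_degrees (p r : nat) : (1 < p)%N ->
  (#|low_degrees p r| ^ 3 * 32 ^ r <= 27 ^ r * (p ^ r) ^ 3)%N.
Proof.
(* From here on [p] is the largest exponent, one less than in the statement. *)
case: p => // p p1; have p0 : (0 < p)%N by [].
pose w (m : {ffun 'I_r -> 'I_p.+1}) := (\prod_i (2 * p - m i))%N.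
have wge m : m \in low_degrees p.+1 r -> ((2 * p) ^ (r * 3) <= w m ^ 3 * 2 ^ r)%N.
  rewrite inE /= => mlow.
  have le : (((2 * p) ^ p) ^ r <= w m ^ p * 2 ^ (\sum_i m i))%N.
    rewrite /w expn_sum (big_morph (expn^~ p) (fun x y => expnMn x y p) (exp1n p)) -big_split /= -[r in (_ ^ r)%N]card_ord -prod_nat_const.
    by apply: leq_prod => i _; apply: agm_weight; rewrite -ltnS.
  rewrite -(leq_exp2r _ _ p0) [X in (_ <= X)%N]expnMn -!expnM.
  have -> : (r * 3 * p = p * r * 3)%N by ring.
  rewrite !expnM; apply: (@leq_trans ((w m ^ p * 2 ^ (\sum_i m i)) ^ 3)%N).
    by rewrite leq_exp2r.
  rewrite expnMn -!expnM [(3 * p)%N]mulnC leq_mul2l leq_exp2l //.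
  by apply/orP; right; rewrite mulnC.
have wsum : (\sum_m w m * 2 ^ r = (3 * p * p.+1) ^ r)%N.
  have -> : (3 * p * p.+1 = (\sum_(d < p.+1) (2 * p - d)) * 2)%N.
    have : (\sum_(d < p.+1) (2 * p - d) + \sum_(d < p.+1) d = p.+1 * (2 * p))%N.
      rewrite -big_split /= -[p.+1 in RHS]card_ord -sum_nat_const.
      by apply: eq_bigr => d _; rewrite subnK //; have := ltn_ord d; lia.
    have gauss n : (2 * \sum_(d < n.+1) d = n * n.+1)%N.
      by elim: n => [|n IH]; rewrite big_ord_recr /= ?big_ord0 // mulnDr IH; ring.
    have := gauss p; move: (\sum_(d < p.+1) d)%N (\sum_(d < p.+1) (2 * p - d))%N => a b.
    by nia.
  rewrite expnMn -big_distrl /=; congr muln.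
  by rewrite -[r in RHS]card_ord -prod_nat_const bigA_distr_bigA.
have m0 : [ffun=> ord0] \in low_degrees p.+1 r.
  by rewrite inE big1 // => i _; rewrite ffunE.
(* Markov's inequality: the number of low-degree elements times their least weight is at most the
   total weight. *)
case: (@arg_minnP _ _ (mem (low_degrees p.+1 r)) w m0) => m /= mlow mmin.
have le0 : (#|low_degrees p.+1 r| * w m <= \sum_m w m)%N.
  rewrite -sum_nat_const [X in (_ <= X)%N](bigID (mem (low_degrees p.+1 r))) /=.
  by apply: leq_trans (leq_addr _ _); apply: leq_sum => i /mmin.
have le1 : (#|low_degrees p.+1 r| * w m * 2 ^ r <= (3 * p * p.+1) ^ r)%N.
  by rewrite -wsum -big_distrl leq_mul2r le0 orbT.
have le2 := wge m mlow.
have pr0 : (0 < p ^ (r * 3) * 2 ^ r)%N by rewrite muln_gt0 !expn_gt0 p0.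
rewrite -(leq_pmul2r pr0).
apply: (@leq_trans ((#|low_degrees p.+1 r| * w m * 2 ^ r) ^ 3 * 2 ^ r)%N).
  move: le2; set c := #|_|; move: (w m) => x le2.
  have -> : ((c * x * 2 ^ r) ^ 3 * 2 ^ r = (c ^ 3 * 2 ^ (r * 3)) * (x ^ 3 * 2 ^ r))%N.
    by rewrite !expnMn -!expnM; ring.
  apply: leq_trans _ (leq_mul (leqnn _) le2).
  rewrite expnMn (_ : 32 = 2 ^ 5)%N // -!expnM.
  have -> : (5 * r = r + r + r + r + r)%N by lia.
  have -> : (r * 3 = r + r + r)%N by lia.
  by rewrite !expnD; apply: eq_leq; ring.
apply: (@leq_trans (((3 * p * p.+1) ^ r) ^ 3 * 2 ^ r)%N).
  by rewrite leq_mul2r leq_exp2r // le1 orbT.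
rewrite (_ : 27 = 3 ^ 3)%N // !expnMn -!expnM.
rewrite !expnM !expnS !expn0 !muln1.
by apply: eq_leq; ring.
Qed.

(** The rank is the [p]-rank for some prime [p]. An elementary abelian [p]-subgroup of that rank is
    a vector space over ['F_p], and [e] is a basis of it. *)
Lemma elementary_rank (G : finZmodType) :
  exists p : nat, exists e : 'I_('r([set: G])%g) -> G,
    [/\ prime p, forall i, e i *+ p = 0 &
      forall k : 'I_('r([set: G])%g) -> nat, \sum_i e i *+ k i = 0 -> forall i, (p %| k i)%N].
Proof.
have [p p_pr ->] := rank_witness [set: G].
exists p; have [E EpE] := p_rank_witness p [set: G].
move: 'r_p([set: G])%g EpE => r /pnElemP[_ abelE Er].
(* The coordinates given by [rVabelem] require a nontrivial subgroup. *)
case: (eqVneq r 0%N) => [r0 | r0].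
  exists (fun=> 0); split=> // [i|k _ i]; first by rewrite mul0rn.
  by have := ltn_ord i; rewrite {2}r0.
have ntE : E :!=: 1%g by apply/eqP => E1; rewrite -Er E1 cards1 logn1 eqxx in r0.
have dimE : r = (abelem_dim' E).+1 by rewrite -Er -(dim_abelemE abelE ntE).
pose iota := rVabelem abelE ntE.
have iotaZ (c : 'F_p) u : iota (c *: u) = iota u *+ c := rVabelemZ abelE ntE c u.
have iotaD : {morph iota : u v / u + v >-> u + v} := rVabelemD abelE ntE.
have iota0 : iota 0 = 0 := rVabelem0 abelE ntE.
have iota_inj : injective iota := @rVabelem_inj _ _ _ abelE ntE.
have iotaMn u k : iota (u *+ k) = iota u *+ k.
  by elim: k => [|k IH]; rewrite ?mulr0n // !mulrS iotaD IH.
exists (fun i => iota (delta_mx 0 (cast_ord dimE i))); split=> // [i|k].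
  by rewrite -iotaMn -scaler_nat pchar_Fp_0 // scale0r.
move=> + i; under eq_bigr => j _ do rewrite -iotaMn.
rewrite -(big_morph iota iotaD iota0) -iota0 => /iota_inj/matrixP/(_ 0 (cast_ord dimE i)).
rewrite summxE (bigD1 i) //= big1 => [|j ji]; last first.
  rewrite mulmxnE mxE eqxx /= (inj_eq (@cast_ord_inj _ _ _)) eq_sym (negPf ji).
  exact: mul0rn.
rewrite addr0 mulmxnE !mxE !eqxx /= => ki.
by rewrite (dvdn_pcharf (pchar_Fp p_pr)) ki.
Qed.

(** The argument [- (x + y)] turns the double sum into a sum over x + y + z = 0. *)
Definition slice_family (G : finZmodType) (F : fieldType) (s : nat) (chi : 'I_s -> G -> F) :=
  forall f g h : G -> F,
    (forall j, \sum_x f x * chi j x = 0) -> (forall j, \sum_x g x * chi j x = 0) ->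
    (forall j, \sum_x h x * chi j x = 0) ->
    \sum_x \sum_y f x * g y * h (- (x + y)) = 0.

(** The span of [e] has [p ^ r] elements; [tau x] represents the coset of [x] and [eps x] holds the
    coordinates of [x - tau x]. *)
Lemma coset_digits (G : finZmodType) (p r : nat) (e : 'I_r -> G) :
  (0 < p)%N -> (forall i, e i *+ p = 0) ->
  (forall k : 'I_r -> nat, \sum_i e i *+ k i = 0 -> forall i, (p %| k i)%N) ->
  exists (tau : G -> G) (eps : G -> {ffun 'I_r -> 'I_p}),
    (forall x, x = tau x + \sum_i e i *+ eps x i) /\
    (#|[set tau x | x in G]| * p ^ r <= #|G|)%N.
Proof.
move=> p0 ep0 eind; pose D := {ffun 'I_r -> 'I_p}.
pose span (k : 'I_r -> nat) : G := \sum_i e i *+ k i.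
have spanD k l : span k + span l = span (fun i => k i + l i)%N.
  by rewrite /span -big_split; apply: eq_bigr => i _; rewrite mulrnDr.
have span_mod k : exists d : D, span k = span (fun i => nat_of_ord (d i)).
  exists [ffun i => Ordinal (ltn_pmod (k i) p0)]; apply: eq_bigr => i _.
  by rewrite ffunE /= {1}(divn_eq (k i) p) mulrnDr mulnC mulrnA ep0 mul0rn add0r.
(* Coefficients are natural numbers, so negation is multiplication by [p - 1]. *)
have spanN k : - span k = span (fun i => p.-1 * k i)%N.
  apply/eqP; rewrite eq_sym -addr_eq0 spanD; apply/eqP; apply: big1 => i _.
  by rewrite -mulSnr prednK // mulrnA ep0 mul0rn.
have span_inj (d d' : D) : span (fun i => nat_of_ord (d i)) = span (fun i => d' i) -> d = d'.
  move=> dd; have /eind E : span (fun i => d i + p.-1 * d' i)%N = 0.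
    by rewrite -spanD -spanN dd subrr.
  apply/ffunP => i; apply: ord_inj.
  have := E i; have := ltn_ord (d i); have := ltn_ord (d' i).
  move: (nat_of_ord (d i)) (nat_of_ord (d' i)) => b a ap bp dv.
  have : (b = a %[mod p])%N.
    apply/eqP; rewrite -(eqn_modDr (p.-1 * a)) -mulSn prednK // modnMr.
    exact: dv.
  by rewrite !modn_small.
pose R x y := [exists d : D, x == y + span (fun i => nat_of_ord (d i))].
have RP x y : reflect (exists k, x = y + span k) (R x y).
  apply: (iffP existsP) => [[d /eqP ->]|[k ->]]; first by exists (fun i => nat_of_ord (d i)).
  by have [d ->] := span_mod k; exists d.
have Rxx x : R x x.
  by apply/RP; exists (fun=> 0%N); rewrite /span big1 ?addr0.
(* The choice depends only on the predicate [R x], which is the same for all [x] of one coset. *)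
pose tau x := odflt x [pick y | R x y].
have Rtau x : R x (tau x).
  by rewrite /tau; case: pickP => [y //|/(_ x)]; rewrite Rxx.
have tauR x y : R x y -> tau x = tau y.
  move=> /RP[k xy]; rewrite /tau.
  have Rxy : R x =1 R y.
    move=> z; apply/RP/RP => -[l E].
      exists (fun i => l i + p.-1 * k i)%N.
      by rewrite -spanD -spanN addrA -E xy addrK.
    by exists (fun i => l i + k i)%N; rewrite -spanD addrA -E.
  rewrite (eq_pick Rxy); case: pickP => [//|/(_ y)]; by rewrite Rxx.
have exeps x : exists d : D, x == tau x + span (fun i => nat_of_ord (d i)) by apply/existsP; exact: Rtau.
exists tau, (fun x => xchoose (exeps x)); split.
  by move=> x; exact/eqP/(xchooseP (exeps x)).
pose f (u : G * D) := u.1 + span (fun i => u.2 i).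
have finj : {in setX [set tau x | x in G] [set: D] &, injective f}.
  move=> [_ d] [_ d'] /setXP[/imsetP[x _ /= ->] _] /setXP[/imsetP[y _ /= ->] _] E.
  have tE z (k : D) : tau (f (tau z, k)) = tau z.
    transitivity (tau (tau z)); first by apply: tauR; apply/RP; exists (fun i => nat_of_ord (k i)).
    by apply/esym/tauR.
  have txy : tau x = tau y by rewrite -(tE x d) -(tE y d') E.
  by move: E; rewrite /f /= txy => /addrI/span_inj ->.
have -> : (#|[set tau x | x in G]| * p ^ r = #|setX [set tau x | x in G] [set: D]|)%N.
  by rewrite cardsX cardsT card_ffun !card_ord.
by rewrite -(card_in_imset finj) max_card.
Qed.

(** There is one condition for each coset of the elementary subgroup and each low-degree monomial in
    the digits. Splitting [f], [g], [h] over cosets reduces the claim to [trilinear_vanish]. *)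
Lemma slice_family_exists (G : finZmodType) (r := 'r([set: G])%g) :
  exists p s : nat,
    [/\ prime p, (s ^ 3 * 32 ^ r <= 27 ^ r * #|G| ^ 3)%N &
      forall F : fieldType, p \in [pchar F] -> exists chi : 'I_s -> G -> F, slice_family chi].
Proof.
have [p [e [p_pr ep0 eind]]] := elementary_rank G.
rewrite -/r in e ep0 eind *; have p0 := prime_gt0 p_pr; have p1 := prime_gt1 p_pr.
have [tau [eps [tauE cardT]]] := coset_digits p0 ep0 eind.
pose T := [set tau x | x in G]; pose La := setX T (low_degrees p r).
exists p, #|La|; split=> //.
  rewrite cardsX expnMn -mulnA; have := card_low_degrees r p1 => le.
  apply: leq_trans (leq_mul (leqnn _) le) _.
  by rewrite mulnCA -expnMn leq_mul2l leq_exp2r // cardT orbT.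
move=> F pF.
pose chi (j : 'I_#|La|) x : F :=
  (tau x == (enum_val j).1)%:R * \prod_i (eps x i)%:R ^+ ((enum_val j).2 i).
exists chi => f g h fc gc hc.
pose loc (f0 : G -> F) t x := f0 x * (tau x == t)%:R.
pose ep x i := nat_of_ord (eps x i).
have locP f0 t : (forall j, \sum_x f0 x * chi j x = 0) ->
    low_moments_vanish p ep (loc f0 t).
  move=> f0c m mp mle.
  case: (boolP (t \in T)) => tT; last first.
    apply: big1 => x _; rewrite /loc; case: eqP => [E|_]; last by rewrite mulr0 mul0r.
    by move: tT; rewrite -E imset_f.
  pose m' : {ffun 'I_r -> 'I_p} := [ffun i => Ordinal (mp i)].
  have lL : (t, m') \in La.
    rewrite inE tT inE /=; under eq_bigr => i _ do rewrite ffunE.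
    exact: mle.
  rewrite -[RHS](f0c (enum_rank_in lL (t, m'))) /chi enum_rankK_in //=.
  apply: eq_bigr => x _; rewrite /loc -!mulrA; congr (_ * (_ * _)).
  by apply: eq_bigr => i _; rewrite ffunE.
transitivity (\sum_t1 \sum_t2 \sum_t3 \sum_x \sum_y \sum_(z | x + y + z == 0)
    loc f t1 x * loc g t2 y * loc h t3 z).
  have ex (A : G -> G -> G -> G -> F) :
      \sum_t \sum_x \sum_y \sum_(z | x + y + z == 0) A t x y z =
      \sum_x \sum_y \sum_(z | x + y + z == 0) \sum_t A t x y z.
    rewrite exchange_big; apply: eq_bigr => x _.
    rewrite exchange_big; apply: eq_bigr => y _.
    by rewrite exchange_big.
  have locsum f0 x : \sum_t loc f0 t x = f0 x.
    rewrite (bigD1 (tau x)) //= /loc eqxx mulr1 big1 ?addr0 // => t.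
    by rewrite eq_sym => /negPf ->; rewrite mulr0.
  symmetry; under eq_bigr => t1 _.
    under eq_bigr => t2 _ do rewrite ex.
    rewrite ex; over.
  rewrite ex; apply: eq_bigr => x _; apply: eq_bigr => y _.
  rewrite (big_pred1 (- (x + y))) => [|z]; last by rewrite addrC addr_eq0.
  rewrite -(locsum f x) -(locsum g y) -(locsum h (- (x + y))) big_distrlr /= big_distrl /=.
  apply: eq_bigr => t1 _; rewrite big_distrl /=; apply: eq_bigr => t2 _.
  by rewrite big_distrr.
apply: big1 => t1 _; apply: big1 => t2 _; apply: big1 => t3 _.
(* If the three cosets contain no triple with sum zero, every term vanishes. Otherwise such a triple
   is a base point, and [k] is minus the sum of its digits modulo [p]. *)
case: (boolP [exists u : G * G * G, [&& u.1.1 + u.1.2 + u.2 == 0, tau u.1.1 == t1,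
    tau u.1.2 == t2 & tau u.2 == t3]]) => [/existsP[[[x0 y0] z0] /=] | ].
  case/and4P => /eqP s0 /eqP tx0 /eqP ty0 /eqP tz0.
  pose k i := (p.-1 * (ep x0 i + ep y0 i + ep z0 i))%N.
  have key x y z : tau x = t1 -> tau y = t2 -> tau z = t3 ->
      (x + y + z == 0) = [forall i, p %| ep x i + ep y i + ep z i + k i]%N.
    move=> tx ty tz.
    have sE a b c : tau a = t1 -> tau b = t2 -> tau c = t3 ->
        a + b + c = t1 + t2 + t3 + \sum_i e i *+ (ep a i + ep b i + ep c i).
      move=> <- <- <-; rewrite {1}(tauE a) {1}(tauE b) {1}(tauE c).
      rewrite (addrACA (tau a)) (addrACA (tau a + tau b)) -!big_split; congr (_ + _).
      by apply: eq_bigr => i _; rewrite !mulrnDr.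
    have -> : x + y + z = \sum_i e i *+ (ep x i + ep y i + ep z i + k i).
      rewrite -[LHS]subr0 -[X in _ - X]s0 (sE x y z) // (sE x0 y0 z0) // opprD addrACA subrr add0r.
      rewrite -sumrB; apply: eq_bigr => i _; rewrite [in RHS]mulrnDr; congr (_ + _).
      apply/eqP; rewrite eq_sym -addr_eq0 -mulrnDr /k -mulSnr prednK //.
      by rewrite mulrnA ep0 mul0rn.
    apply/eqP/forallP => [/eind //| dv].
    apply: big1 => i _; have /dvdnP[q ->] := dv i.
    by rewrite mulnC mulrnA ep0 mul0rn.
  rewrite -[RHS](@trilinear_vanish F p r G G G ep ep ep k (loc f t1) (loc g t2) (loc h t3)) //;
    try exact: locP.
  apply: eq_bigr => x _; apply: eq_bigr => y _.
  rewrite big_mkcond [RHS]big_mkcond; apply: eq_bigr => z _.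
  rewrite /loc; case: (tau x =P t1) => tx; last by rewrite !(mulr0, mul0r) !if_same.
  case: (tau y =P t2) => ty; last by rewrite !(mulr0, mul0r) !if_same.
  case: (tau z =P t3) => tz; last by rewrite !(mulr0, mul0r) !if_same.
  by rewrite key.
rewrite negb_exists => /forallP no.
apply: big1 => x _; apply: big1 => y _; apply: big1 => z sz.
have := no (x, y, z); rewrite /= sz /loc.
case: (tau x == t1); last by rewrite mulr0 !mul0r.
case: (tau y == t2); last by rewrite mulr0 mulr0 mul0r.
by case: (tau z == t3) => // _; rewrite !mulr0.
Qed.

(** * The rank of a group with a large double product family *)

(** This form fits the bound on the number of roots of a polynomial. *)
Definition infinite_field (F : fieldType) :=
  forall n, exists s : seq F, uniq s /\ size s = n.

Lemma nonroot_exists (F : fieldType) (p : {poly F}) :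
  infinite_field F -> p != 0 -> exists t, ~~ root p t.
Proof.
move=> infF p0; have [s [us ss]] := infF (size p).
case: (boolP (all (root p) s)) => [ar|]; last by rewrite -has_predC => /hasP[t _ ?]; exists t.
by have := max_poly_roots p0 ar us; rewrite ss ltnn.
Qed.

(* If u N v <> 0, bordering an invertible r x r minor of M (with r = \rank M)
   by u and v gives a minor of M + t N of size r + 1 whose determinant is t
   times a polynomial in t with constant term u N v. *)
Lemma max_rank_kernel (F : fieldType) (m n : nat) (M N : 'M[F]_(m, n))
    (u : 'rV[F]_m) (v : 'cV[F]_n) :
  infinite_field F -> (forall t, \rank (M + t *: N)%R <= \rank M)%N ->
  u *m M = 0 -> M *m v = 0 -> u *m N *m v = 0.
Proof.
move=> infF maxM uM Mv; set r := \rank M in maxM.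
apply/eqP; apply: contraT => uNv.
have [A AE] : exists A : 'M_(r, m), A *m col_base M = 1%:M.
  have : row_free (col_base M)^T by rewrite /row_free mxrank_tr (eqP (col_base_full M)).
  case/row_freeP => A' /(congr1 trmx); rewrite trmx_mul trmxK trmx1 => E; by exists A'^T.
have [B BE] : exists B : 'M_(n, r), row_base M *m B = 1%:M.
  by apply/row_freeP; exact: row_base_free.
have AMB : A *m M *m B = 1%:M.
  by rewrite -[M in A *m M]mulmx_base mulmxA AE mul1mx BE.
pose c := u *m N *m v.
pose P := A *m N *m B; pose q := A *m N *m v; pose w := u *m N *m B.
pose C := map_mx (@polyC F).
pose Q : 'M[{poly F}]_(r + 1) :=
  block_mx (1%:M + 'X *: C _ _ P) ('X *: C _ _ q) (C _ _ w) (C _ _ c).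
have QE t : map_mx (horner_eval t) Q = block_mx (1%:M + t *: P) (t *: q) w c.
  rewrite map_block_mx; congr block_mx; apply/matrixP => i j;
    rewrite !mxE /horner_eval ?hornerD ?hornerM ?hornerX ?hornerC //.
  by rewrite hornerMn hornerC.
have detE t : (\det Q).[t] = \det (block_mx (1%:M + t *: P) (t *: q) w c).
  by rewrite -QE det_map_mx.
(* At 0 the matrix [Q] is block triangular with determinant [u N v]; the factor ['X] forces the
   chosen [t] to be nonzero. *)
have Q0 : 'X * \det Q != 0.
  rewrite mulf_neq0 ?polyX_eq0 //; apply/eqP => /(congr1 (horner_eval 0)).
  rewrite /horner_eval horner0 detE !scale0r addr0 det_lblock det1 mul1r.
  rewrite [c]mx11_scalar det_scalar1 => c0; move: uNv; rewrite -/c [c]mx11_scalar c0.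
  by rewrite raddf0 eqxx.
have [t] := nonroot_exists infF Q0.
rewrite rootM negb_or rootX => /andP[t0]; rewrite rootE detE => dt.
(* Multiplying by [t] restores the bottom row, from which [t] was divided out in [Q]. *)
have WE : block_mx 1%:M 0 0 t%:M *m block_mx (1%:M + t *: P) (t *: q) w c =
    col_mx A u *m (M + t *: N) *m row_mx B v.
  rewrite mulmx_block !mul1mx !mul0mx !addr0 !add0r !mul_scalar_mx.
  rewrite mul_col_mx mul_col_row !mulmxDr !mulmxDl uM mul0mx AMB.
  rewrite -[A *m M *m v]mulmxA Mv mulmx0 mul0mx !add0r.
  by rewrite -!scalemxAr -!scalemxAl.
have : (r + 1 <= \rank (M + t *: N)%R)%N.
  apply: (@leq_trans (\rank (col_mx A u *m (M + t *: N) *m row_mx B v)%R)); last first.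
    by have le := mxrankM_maxl (col_mx A u *m (M + t *: N)) (row_mx B v);
      apply: (leq_trans le); exact: mxrankM_maxr.
  have WU : block_mx 1%:M 0 0 t%:M *m block_mx (1%:M + t *: P) (t *: q) w c \in unitmx.
    by rewrite unitmxE det_mulmx det_ublock det1 mul1r det_scalar1 unitfE mulf_neq0.
  by rewrite -WE mxrank_unit.
by move=> le; have := leq_trans le (maxM t); rewrite addn1 ltnn.
Qed.

Lemma max_rank_kernelmx (F : fieldType) (m n a b : nat) (M N : 'M[F]_(m, n))
    (U : 'M[F]_(a, m)) (V : 'M[F]_(n, b)) :
  infinite_field F -> (forall t, \rank (M + t *: N)%R <= \rank M)%N ->
  U *m M = 0 -> M *m V = 0 -> U *m N *m V = 0.
Proof.
move=> infF maxM UM MV; apply/matrixP => k l.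
have := @max_rank_kernel F m n M N (delta_mx 0 k *m U) (V *m delta_mx l 0) infF maxM.
rewrite -mulmxA UM mulmx0 mulmxA MV mul0mx => /(_ erefl erefl)/matrixP/(_ 0 0).
by rewrite !mulmxA -!(mulmxA (delta_mx 0 k)) -rowE -colE !mxE.
Qed.

(** * Ranks of the blocks of an admissible function *)

Section SliceBound.
Variables (G : finZmodType) (F : fieldType) (s : nat) (chi : 'I_s -> G -> F).
Variables (I : finType) (A B : I -> {set G}).
Hypothesis infF : infinite_field F.
Hypothesis chiP : slice_family chi.
Hypothesis sdAB : sdpp (fun i => mem (A i)) (fun i => mem (B i)).
Hypothesis ntA : forall i, (0 < #|A i|)%N.
Hypothesis ntB : forall i, (0 < #|B i|)%N.

(* mat h is the matrix of (a, b) |-> h (b - a) on the union of the A i times the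
   union of the B i; for admissible h, the second part of the double product
   property makes it block diagonal with blocks blk h i. *)
Let sel (S : {set G}) : 'M[F]_(#|S|, #|G|) :=
  \matrix_(k, x) (enum_val k == enum_val x)%:R.

Let diff z := [exists i, exists a in A i, exists b in B i, z == b - a].
Let admissible (h : G -> F) :=
  (forall j, \sum_x h x * chi j x = 0) /\ (forall z, h z != 0 -> diff z).

Let mat (h : G -> F) : 'M[F]_#|G| := \matrix_(x, y)
  (if (enum_val x \in \bigcup_i A i) && (enum_val y \in \bigcup_i B i)
   then h (enum_val y - enum_val x) else 0).
Let blk (h : G -> F) i : 'M[F]_(#|A i|, #|B i|) :=
  \matrix_(k, l) h (enum_val l - enum_val k).

Lemma sumG (f : G -> F) : \sum_x f x = \sum_(i < #|G|) f (enum_val i).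
Proof. by rewrite (big_enum_val (A := G)). Qed.

(** The support of [h] gives [b - a = b' - a'] with [a'], [b'] from a common pair [j]; the second
    part of the double product property then links [i] to [l] through [j]. *)
Lemma diff_block h i l a b : admissible h -> a \in A i -> b \in B l -> h (b - a) != 0 -> i = l.
Proof.
move=> [_ hD] aA bB /hD/existsP[j /existsP[a' /andP[aA' /existsP[b' /andP[bB' /eqP e]]]]].
case: sdAB => _ sd2; apply: (sd2 i j l a a' b' b) => //.
rewrite -[RHS](subrr (b - a)) {1}e opprB -addrA addrACA [RHS]addrACA.
by congr (_ + _); exact: addrC.
Qed.

(** A row vector orthogonal to the conditions on the [A i] and a column vector orthogonal to those
    on the [B i], after a sign change, pair to zero under [mat h] by [slice_family], because [h]
    satisfies the conditions too. Each side costs at most [s] dimensions. *)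
Lemma mat_rank h : admissible h -> (\rank (mat h) <= 2 * s)%N.
Proof.
move=> [hc hD].
pose C1 : 'M[F]_(#|G|, s) := \matrix_(x, j)
  (if enum_val x \in \bigcup_i A i then chi j (enum_val x) else 0).
pose C2 : 'M[F]_(#|G|, s) := \matrix_(y, j)
  (if enum_val y \in \bigcup_i B i then chi j (- enum_val y) else 0).
suff K0 : kermx C1 *m mat h *m (kermx C2)^T = 0.
  have := mxrank_mul_min (kermx C1) (mat h).
  have := mxrank_mul_min (kermx C1 *m mat h) (kermx C2)^T.
  rewrite K0 mxrank0 mxrank_tr !mxrank_ker.
  have := rank_leq_col C1; have := rank_leq_col C2.
  have := rank_leq_row C1; have := rank_leq_row C2.
  lia.
move: (mulmx_ker C1) (mulmx_ker C2); move: (kermx C1) (kermx C2) => K1 K2 KC1 KC2.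
apply/matrixP => i j; rewrite [RHS]mxE.
have keri (C : 'M[F]_(#|G|, s)) (K : 'M[F]_#|G|) (i0 : 'I_#|G|) k : K *m C = 0 -> \sum_x K i0 x * C x k = 0.
  by move=> /matrixP/(_ i0 k); rewrite !mxE.
pose f x := if x \in \bigcup_i A i then K1 i (enum_rank x) else 0.
pose g y := if - y \in \bigcup_i B i then K2 j (enum_rank (- y)) else 0.
have fc k : \sum_x f x * chi k x = 0.
  rewrite sumG -[RHS](keri C1 K1 i k KC1); apply: eq_bigr => x _.
  by rewrite /f mxE enum_valK; case: ifP; rewrite ?mul0r ?mulr0.
have gc k : \sum_x g x * chi k x = 0.
  rewrite (reindex_inj oppr_inj) sumG -[RHS](keri C2 K2 j k KC2); apply: eq_bigr => x _.
  by rewrite /g mxE opprK enum_valK; case: ifP; rewrite ?mul0r ?mulr0.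
rewrite -[RHS](chiP fc gc hc) mxE sumG.
under eq_bigr => y _ do rewrite !mxE mulr_suml.
rewrite exchange_big; apply: eq_bigr => x _ /=.
rewrite [RHS](reindex_inj oppr_inj) sumG; apply: eq_bigr => y _.
rewrite /f /g !mxE opprD !opprK enum_valK enum_valK [- _ + _]addrC.
by do 2![case: (_ \in _)] => /=; ring.
Qed.

Lemma sum_sel (S : {set G}) (f : G -> F) z :
  \sum_(l < #|S|) f (enum_val l) * (enum_val l == z)%:R = if z \in S then f z else 0.
Proof.
rewrite -(big_enum_val (A := mem S) (fun b => f b * (b == z)%:R)).
case: ifP => zS.
  rewrite (bigD1 z) //= eqxx mulr1 big1 ?addr0 // => b /andP[_ /negPf ->].
  by rewrite mulr0.
by apply: big1 => b bS; case: eqP => [e|]; rewrite ?mulr0 //; rewrite -e bS in zS.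
Qed.

Lemma sel_mul (S : {set G}) n (M : 'M[F]_(#|G|, n)) k y :
  (sel S *m M) k y = M (enum_rank (enum_val k)) y.
Proof.
rewrite mxE (bigD1 (enum_rank (enum_val k))) //= mxE enum_rankK eqxx mul1r big1 ?addr0 // => x xk.
rewrite mxE; case: eqP => [e|]; rewrite ?mul0r //.
by move: xk; rewrite e enum_valK eqxx.
Qed.

Lemma sel_diag S : sel S *m (sel S)^T = 1%:M.
Proof.
by apply/matrixP => k l; rewrite sel_mul !mxE enum_rankK eq_sym (inj_eq enum_val_inj).
Qed.

Lemma sel_disjoint (S T : {set G}) : [disjoint S & T] -> sel S *m (sel T)^T = 0.
Proof.
move=> dST; apply/matrixP => k l; rewrite sel_mul !mxE enum_rankK.
case: eqP => // e; have := disjointFr dST (enum_valP k).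
by rewrite -e enum_valP.
Qed.

Lemma mat_blk h i : sel (A i) *m mat h *m (sel (B i))^T = blk h i.
Proof.
apply/matrixP => k l; transitivity ((sel (B i) *m (sel (A i) *m mat h)^T)^T k l); first by rewrite trmx_mul trmxK.
rewrite [LHS]mxE sel_mul [LHS]mxE sel_mul !mxE !enum_rankK.
have -> : enum_val k \in \bigcup_i A i by apply/bigcupP; exists i; rewrite ?enum_valP.
by have -> : enum_val l \in \bigcup_i B i by apply/bigcupP; exists i; rewrite ?enum_valP.
Qed.

(** By [diff_block], the rows indexed by [A i] vanish outside the columns of [B i]. *)
Lemma sel_mat h i : admissible h -> sel (A i) *m mat h = blk h i *m sel (B i).
Proof.
move=> ah; apply/matrixP => k y; rewrite sel_mul [LHS]mxE [RHS]mxE enum_rankK.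
rewrite [RHS](eq_bigr (fun l => h (enum_val l - enum_val k) * (enum_val l == enum_val y)%:R))
  => [|l _]; last by rewrite !mxE.
rewrite (sum_sel _ (fun b => h (b - enum_val k))).
have -> : enum_val k \in \bigcup_i A i by apply/bigcupP; exists i; rewrite ?enum_valP.
case: bigcupP => [[l _ yl] /= | no]; last first.
  by case: ifP => // yi; case: no; exists i.
case: ifP => // yi; apply/eqP; apply: contraFT yi => h0.
by rewrite (diff_block ah (enum_valP k) yl h0).
Qed.

Lemma mat_sel h i : admissible h -> mat h *m (sel (B i))^T = (sel (A i))^T *m blk h i.
Proof.
move=> ah; apply/trmx_inj; rewrite trmx_mul trmxK [RHS]trmx_mul trmxK.
apply/matrixP => k y; rewrite sel_mul [LHS]mxE [LHS]mxE [RHS]mxE enum_rankK.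
rewrite [RHS](eq_bigr (fun l => h (enum_val k - enum_val l) * (enum_val l == enum_val y)%:R))
  => [|l _]; last by rewrite !mxE.
rewrite (sum_sel _ (fun a => h (enum_val k - a))).
have -> : enum_val k \in \bigcup_i B i by apply/bigcupP; exists i; rewrite ?enum_valP.
rewrite andbT; case: bigcupP => [[l _ yl] /= | no]; last first.
  by case: ifP => // yi; case: no; exists i.
case: ifP => // yi; apply/eqP; apply: contraFT yi => h0.
by rewrite -(diff_block ah yl (enum_valP k) h0).
Qed.

Lemma A_disjoint i j : i != j -> [disjoint A i & A j].
Proof.
move=> ij; apply/pred0P => x; apply/negbTE/negP => /andP[/= xi xj].
have /card_gt0P[b bB] := ntB j.
by case/eqP: ij; exact: (sdpp_disjoint sdAB xi xj bB).
Qed.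

Lemma B_disjoint i j : i != j -> [disjoint B i & B j].
Proof.
move=> ij; apply/pred0P => x; apply/negbTE/negP => /andP[/= xi xj].
have /card_gt0P[a aA] := ntA i; case/eqP: ij.
have [_ sd2] := sdAB.
by apply: (sd2 i i j a a x x) => //; rewrite subrr add0r subrr.
Qed.

(** The row spaces of the blocks lie in that of [mat h], and they are independent because the [B i]
    are disjoint. *)
Lemma sum_blk_rank h : admissible h -> (\sum_i \rank (blk h i) <= \rank (mat h))%N.
Proof.
move=> ah; pose V i := <<blk h i *m sel (B i)>>%MS.
have rV i : \rank (V i) = \rank (blk h i).
  rewrite genmxE mxrankMfree //; apply/row_freeP.
  by exists (sel (B i))^T; exact: sel_diag.
have dV : mxdirect (\sum_i V i).
  apply/mxdirect_sumsP => i _; set X := (_ :&: _)%MS.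
  have XV : (X <= V i)%MS by exact: capmxSl.
  have : (X <= \sum_(j | j != i) V j)%MS by exact: capmxSr.
  move=> Xs; have X0 : X *m (sel (B i))^T = 0.
    apply/sub_kermxP; apply: submx_trans Xs _; apply/sumsmx_subP => j ji.
    by rewrite genmxE; apply/sub_kermxP; rewrite -mulmxA sel_disjoint ?mulmx0 // B_disjoint.
  move: XV; rewrite genmxE => /submxP[D XD].
  by move: X0; rewrite XD -!mulmxA sel_diag mulmx1 => D0; rewrite mulmxA D0 mul0mx.
under eq_bigr => i _ do rewrite -rV.
rewrite -(mxdirectP dV) /=; apply: mxrankS; apply/sumsmx_subP => i _.
by rewrite genmxE -sel_mat // submxMl.
Qed.

(* A matrix X supported on A i x B i is blk g i for a function g; it is
   admissible once it satisfies the s linear conditions given by chi, and then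
   maximality of the rank of mat h kills X on the kernels of blk h i. *)
Lemma blk_defect h i : admissible h ->
  (forall g t, admissible g -> \rank (mat h + t *: mat g)%R <= \rank (mat h))%N ->
  ((#|A i| - \rank (blk h i)) * (#|B i| - \rank (blk h i)) <= s)%N.
Proof.
move=> ah maxh.
pose K1 := row_base (kermx (blk h i)); pose K2 := row_base (kermx (blk h i)^T).
have K1h : K1 *m blk h i = 0.
  by apply/sub_kermxP; rewrite eq_row_base.
have K2h : blk h i *m K2^T = 0.
  apply: trmx_inj; rewrite trmx_mul trmxK trmx0.
  by apply/sub_kermxP; rewrite eq_row_base.
have kill g : admissible g -> K1 *m blk g i *m K2^T = 0.
  move=> ag; rewrite -(mat_blk g) !mulmxA -[K1 *m _ *m _ *m _ *m _]mulmxA.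
  apply: (max_rank_kernelmx (M := mat h)) => //; first by move=> t; exact: maxh.
    by rewrite -mulmxA sel_mat // mulmxA K1h mul0mx.
  by rewrite mulmxA mat_sel // -mulmxA K2h mulmx0.
pose Cm : 'M[F]_(#|A i| * #|B i|, s) :=
  \matrix_(q, j) mxvec (\matrix_(k, l) chi j (enum_val l - enum_val k) : 'M[F]_(#|A i|, #|B i|)) 0 q.
have CmE X j : (mxvec X *m Cm) 0 j = \sum_k \sum_l X k l * chi j (enum_val l - enum_val k).
  rewrite mxE (reindex _ (curry_mxvec_bij _ _)) /= pair_bigA /=.
  by apply: eq_bigr => -[k l] _ /=; rewrite mxE !mxvecE mxE.
pose Phi := lin_mulmx K1 *m lin_mulmxr K2^T.
have PhiE X : mxvec X *m Phi = mxvec (K1 *m X *m K2^T).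
  by rewrite /Phi mulmxA !mul_vec_lin.
have sub : (kermx Cm <= kermx Phi)%MS.
  apply/rV_subP => w /sub_kermxP wC; apply/sub_kermxP.
  rewrite -[w]vec_mxK PhiE; move: (vec_mx w) (vec_mxK w) => X wX; rewrite -wX in wC.
  (* By the first part of the double product property the differences over [A i] and [B i] are
     distinct, so [g] takes each entry of [X] separately. *)
  pose g z := \sum_k \sum_l X k l * (z == enum_val l - enum_val k)%:R.
  have gX : blk g i = X.
    apply/matrixP => k l; rewrite mxE /g.
    have E k' l' : enum_val l - enum_val k = enum_val l' - enum_val k' -> k = k' /\ l = l'.
      move=> e; case: sdAB => sd1 _.
      have e' : enum_val k - enum_val k' = enum_val l - enum_val l'.
        by move/eqP: e; rewrite subr_eq => /eqP ->; rewrite -[RHS]addrA [RHS]addrC addrA subrK.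
      have [] := sd1 i _ _ _ _ (enum_valP k) (enum_valP k') (enum_valP l) (enum_valP l') e'.
      by move=> /enum_val_inj -> /enum_val_inj ->.
    rewrite (bigD1 k) //= (bigD1 l) //= eqxx mulr1 big1 => [|l' ll'].
      rewrite addr0 big1 ?addr0 // => k' kk'; apply: big1 => l' _.
      case: eqP => [/E[kk _]|]; rewrite ?mulr0 //.
      by rewrite kk eqxx in kk'.
    case: eqP => [/E[_ ll]|]; rewrite ?mulr0 //.
    by rewrite ll eqxx in ll'.
  rewrite -gX kill ?linear0 //; split.
    move=> j; transitivity ((mxvec X *m Cm) 0 j); last by rewrite wC mxE.
    rewrite CmE /g; under eq_bigr => z _ do rewrite mulr_suml.
    rewrite exchange_big; apply: eq_bigr => k _.
    under eq_bigr => z _ do rewrite mulr_suml.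
    rewrite exchange_big; apply: eq_bigr => l _.
    rewrite (bigD1 (enum_val l - enum_val k)) //= eqxx mulr1 big1 ?addr0 // => z /negPf ->.
    by rewrite mulr0 mul0r.
  move=> z gz; apply/existsP; exists i; apply: contraR gz => no.
  apply/eqP; apply: big1 => k _; apply: big1 => l _.
  case: eqP => [e|]; rewrite ?mulr0 //; case/negP: no.
  apply/existsP; exists (enum_val k); rewrite enum_valP /=.
  by apply/existsP; exists (enum_val l); rewrite enum_valP e /=.
have full : row_full Phi.
  have [R1 KR1] := row_freeP (row_base_free (kermx (blk h i))).
  have [R2 KR2] := row_freeP (row_base_free (kermx (blk h i)^T)).
  rewrite -sub1mx; apply/row_subP => q; apply/submxP.
  exists (mxvec (R1 *m vec_mx (row q 1%:M) *m R2^T)).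
  rewrite PhiE !mulmxA KR1 mul1mx -mulmxA -trmx_mul KR2 trmx1 mulmx1.
  by rewrite vec_mxK.
(* The kernel of [Cm] has codimension at most [s], and that of the surjective [Phi] has codimension
   the product of the two defects. *)
have := mxrankS sub; rewrite !mxrank_ker.
have := rank_leq_col Cm; have := rank_leq_row Phi; have := rank_leq_row Cm.
have : \rank Phi = ((#|A i| - \rank (blk h i)) * (#|B i| - \rank (blk h i)))%N.
  by rewrite (eqP full) !mxrank_ker mxrank_tr.
lia.
Qed.

(** Ranks are at most [#|G|], so a maximum exists; admissible functions form a linear space, so
    [mat h + t *: mat g] competes with it. *)
Lemma admissible_max : exists2 h, admissible h &
  forall g t, admissible g -> (\rank (mat h + t *: mat g)%R <= \rank (mat h))%N.
Proof.
suff [h ah hmax] : exists2 h, admissible h & forall g, admissible g -> (\rank (mat g) <= \rank (mat h))%N.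
  exists h => // g t ag; have -> : mat h + t *: mat g = mat (fun z => h z + t * g z).
    by apply/matrixP => x y; rewrite !mxE; case: ifP => // _; rewrite mulr0 addr0.
  apply: hmax; case: ah ag => hc hD [gc gD]; split.
    move=> j; under eq_bigr => x _ do rewrite mulrDl -mulrA.
    by rewrite big_split /= -mulr_sumr hc gc mulr0 addr0.
  move=> z; apply: contraR => nz.
  have -> : h z = 0 by apply/eqP; apply: contraR nz => /hD.
  have -> : g z = 0 by apply/eqP; apply: contraR nz => /gD.
  by rewrite mulr0 addr0.
have main d h : admissible h -> (#|G| - \rank (mat h) <= d)%N ->
    exists2 h, admissible h & forall g, admissible g -> (\rank (mat g) <= \rank (mat h))%N.
  elim: d h => [|d IH] h ah hd.
    exists h => // g _; apply: leq_trans (rank_leq_row _) _.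
    by rewrite -subn_eq0 -leqn0.
  (* Over an infinite field there is no finite search for [g], hence the excluded middle. *)
  have [[g [ag lt]]|no] := boolp.EM (exists g, admissible g /\ (\rank (mat h) < \rank (mat g))%N).
    by apply: (IH g ag); have := rank_leq_row (mat g); lia.
  exists h => // g ag; rewrite leqNgt; apply/negP => lt; apply: no.
  by exists g.
apply: (main #|G| (fun=> 0)); last exact: leq_subr.
split=> [j|z]; last by rewrite eqxx.
by apply: big1 => x _; rewrite mul0r.
Qed.

Lemma two_le_cross (c x y u v : nat) :
  (c <= x * y -> c <= u * v -> 2 * c <= x * v + u * y)%N.
Proof.
move=> h1 h2; rewrite -leq_sqr; apply: leq_trans (nat_AGM2 _ _).
have -> : (x * v * (u * y) = (x * y) * (u * v))%N by ring.
by rewrite expnMn leq_mul2l /= -mulnn leq_mul.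
Qed.

(** Cauchy-Schwarz without square roots: symmetrize the double sum and apply AM-GM to each pair of
    indices. *)
Lemma cauchy_const (J : finType) (c : nat) (a b : J -> nat) :
  (forall i, c <= a i * b i)%N -> (#|J| ^ 2 * c <= (\sum_i a i) * \sum_i b i)%N.
Proof.
move=> cab; rewrite -(leq_pmul2l (isT : 0 < 2)%N).
have -> : (2 * ((\sum_i a i) * \sum_i b i) = \sum_i \sum_j (a i * b j + a j * b i))%N.
  rewrite [RHS](eq_bigr (fun i => a i * (\sum_j b j) + (\sum_j a j) * b i)%N) => [|i _].
    by rewrite big_split -big_distrl -big_distrr /= addnn -mul2n.
  by rewrite big_split -big_distrr -big_distrl.
rewrite mulnCA -mulnn -mulnA -!sum_nat_const.
by apply: leq_sum => i _; apply: leq_sum => j _; exact: two_le_cross.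
Qed.

(** With [a], [b] the sizes of a pair and [rho] its block rank, [(a - rho)(b - rho) <= s] and
    [mu <= ab] give [mu - s <= rho (a + b)]. By Cauchy-Schwarz, [#|I|^2 (mu - s)] is at most the sum
    of the [rho], bounded by [2s], times the sum of all sizes, bounded by [2 #|G|]. *)
Lemma slice_bound_nonempty (mu : nat) : (forall i, mu <= #|A i| * #|B i|)%N ->
  (#|I| ^ 2 * mu <= s * (4 * #|G| + #|I| ^ 2))%N.
Proof.
move=> muAB; have [h ah hmax] := admissible_max.
pose rho i := \rank (blk h i).
have le i : (mu - s <= rho i * (#|A i| + #|B i|))%N.
  have := blk_defect i ah hmax; have := muAB i; rewrite -/(rho i).
  have : (rho i <= #|A i|)%N by exact: rank_leq_row.
  have : (rho i <= #|B i|)%N by exact: rank_leq_col.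
  move: (rho i) #|A i| #|B i| => x a b xb xa le1 le2.
  have [a' ea] : exists a', (a = a' + x)%N by exists (a - x)%N; lia.
  have [b' eb] : exists b', (b = b' + x)%N by exists (b - x)%N; lia.
  subst a b; rewrite !addnK in le2; nia.
have := cauchy_const le.
have le2s : (\sum_i rho i <= 2 * s)%N.
  exact: leq_trans (sum_blk_rank ah) (mat_rank ah).
have disj (C : I -> {set G}) : (forall i j, i != j -> [disjoint C i & C j]) ->
    (\sum_i #|C i| <= #|G|)%N.
  move=> dC; under eq_bigr => i _ do rewrite -sum1_card.
  rewrite (exchange_big_dep predT) //= -[#|G|]sum1_card; apply: leq_sum => x _.
  rewrite sum1_card; apply/card_le1_eqP => i j xi xj.
  have {}xi : x \in C i := xi; have {}xj : x \in C j := xj.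
  apply/eqP; apply: contraT => ij.
  by have := disjointFr (dC _ _ ij) xj; rewrite xi.
have := disj A A_disjoint; have := disj B B_disjoint; rewrite big_split /=.
move: (\sum_i #|A i|)%N (\sum_i #|B i|)%N => a b bG aG.
move: (\sum_i rho i)%N le2s => x xs le1.
have le2 : (x * (a + b) <= 2 * s * (#|G| + #|G|))%N by apply: leq_mul => //; apply: leq_add.
have le3 : (#|I| ^ 2 * mu <= #|I| ^ 2 * (mu - s) + #|I| ^ 2 * s)%N.
  by rewrite -mulnDr leq_mul2l; lia.
by nia.
Qed.
End SliceBound.

Lemma fraction_infinite (F : fieldType) : infinite_field {fraction {poly F}}.
Proof.
move=> n; exists [seq tofrac ('X^i : {poly F}) | i <- iota 0 n]; split; last by rewrite size_map size_iota.
rewrite map_inj_uniq ?iota_uniq // => i j /eqP; rewrite tofrac_eq => /eqP/(congr1 (size \o polyseq)).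
by rewrite /= !size_polyXn => -[].
Qed.

(** Both bounds on the number of conditions are taken over the rational functions over ['F_p], an
    infinite field of the right characteristic; positivity of [mu] makes all the sets nonempty. *)
Lemma sdpp_rank_bound (G : finZmodType) (n mu : nat) (A B : 'I_n -> {set G})
    (r := 'r([set: G])%g) :
  sdpp (fun i => mem (A i)) (fun i => mem (B i)) ->
  (0 < mu)%N -> (forall i, mu <= #|A i| * #|B i|)%N ->
  exists s : nat, (s ^ 3 * 32 ^ r <= 27 ^ r * #|G| ^ 3)%N /\
    (n ^ 2 * mu <= s * (4 * #|G| + n ^ 2))%N.
Proof.
move=> sd mu0 muAB; have [p [s [p_pr sle sF]]] := slice_family_exists G.
pose F : fieldType := {fraction {poly 'F_p}}.
have pF : p \in [pchar F].
  have := pchar_Fp p_pr; rewrite !inE p_pr /= => /eqP pF.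
  rewrite -(rmorph_nat (@tofrac {poly 'F_p})) -polyC_natr.
  by rewrite pF rmorph0.
have [chi chiP] := sF F pF.
exists s; split=> //; rewrite -[n in (n ^ 2)%N]card_ord.
have AB0 i : (0 < #|A i|)%N && (0 < #|B i|)%N by rewrite -muln_gt0 (leq_trans mu0).
apply: (slice_bound_nonempty (@fraction_infinite _) chiP sd) => // i;
  by case/andP: (AB0 i).
Qed.

(** * Asymptotics *)

From mathcomp Require Import all_classical all_reals all_analysis.

Import Order.TTheory GRing.Theory Num.Theory.
Import numFieldNormedType.Exports.

Local Open Scope classical_set_scope.
Local Open Scope ring_scope.

(** Take [k] with [8 Q^k <= N + 1 <= 8 Q^(k+1)]. The surplus [Q^(ke)] absorbs the polynomial loss
    [km + 1], and the gap between consecutive powers costs a constant. *)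
Lemma geometric_growth (R : realType) (V : nat -> nat) (Q Y b : R) (m : nat) (e : R) :
  (1 < Q) -> 0 <= b -> 0 < e -> Q `^ (b + e) <= Y ->
  (forall N, 0 < V N)%N ->
  (forall k N, 8 * Q ^+ k <= N.+1%:R -> Y ^+ k <= (k * m).+1%:R * (V N)%:R) ->
  exists c : R, 0 < c /\ forall N, c * N.+1%:R `^ b <= (V N)%:R.
Proof.
move=> Q1 b0 e0 QY V0 VY.
have Q0 : 0 < Q by apply: lt_trans Q1.
pose x := e * ln Q.
have x0 : 0 < x by rewrite mulr_gt0 // ln_gt0.
(* Chosen so that [km + 1 <= C (1 + kx) <= C Q^(ke)]. *)
pose C := 1 + m%:R / x.
have C1 : 1 <= C by rewrite lerDl divr_ge0 // ltW.
have C0 : 0 < C by apply: lt_le_trans C1.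
have Qb1 : 1 <= Q `^ b by rewrite -[X in X <= _](powRr0 Q) ler_powR // ltW.
pose c := (C * 8 `^ b * Q `^ b)^-1.
have p8 : 0 < 8 `^ b :> R by rewrite powR_gt0.
have pQ : 0 < Q `^ b by rewrite powR_gt0.
exists c; split; first by rewrite invr_gt0 !mulr_gt0.
move=> N; rewrite mulrC ler_pdivrMr ?mulr_gt0 //.
have V1 : 1 <= (V N)%:R :> R by rewrite ler1n.
(* Below 8 no [k] is available, and [1 <= V N] is enough. *)
have [N8|N8] := ltP (N.+1%:R : R) 8.
  apply: (@le_trans _ _ (8 `^ b)).
    by apply: ge0_ler_powR => //; rewrite ?nnegrE // ltW.
  rewrite (_ : _ * (C * _ * _) = (V N)%:R * (C * Q `^ b) * 8 `^ b); last by ring.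
  by rewrite ler_peMl ?mulr_ege1 // ltW.
have [k [kl ku]] : exists k, 8 * Q ^+ k <= N.+1%:R /\ N.+1%:R <= 8 * Q ^+ k.+1.
  have exk : exists k, N.+1%:R < 8 * Q ^+ k.
    pose y := N.+1%:R / ln Q; exists (Num.bound y).
    have lnQ0 : 0 < ln Q by rewrite ln_gt0.
    have y0 : 0 <= y by rewrite divr_ge0 // ltW.
    have := archi_boundP y0; rewrite ltr_pdivrMr // => /lt_le_trans; apply.
    apply: (@le_trans _ _ (expR (ln Q * (Num.bound y)%:R))).
      by apply: le_trans (expR_ge1Dx _); rewrite mulrC lerDr.
    by rewrite expRM_natr lnK ?posrE // ler_peMl ?exprn_ge0 ?(ltW Q0) // ler1n.
  case: (ex_minnP exk) => -[|k] kP kmin; first by move: kP; rewrite expr0 mulr1 ltNge N8.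
  exists k; split; last exact: ltW.
  by rewrite leNgt; apply/negP => /kmin; rewrite ltnn.
have step1 : N.+1%:R `^ b <= 8 `^ b * Q `^ b * (Q `^ b) ^+ k.
  apply: (@le_trans _ _ ((8 * Q ^+ k.+1) `^ b)).
    by apply: ge0_ler_powR => //; rewrite nnegrE // mulr_ge0 // exprn_ge0 // ltW.
  rewrite powRM ?exprn_ge0 ?(ltW Q0) // -mulrA -exprS.
  by rewrite -!powR_mulrn ?powR_ge0 ?(ltW Q0) // -!powRrM mulrC [_ * b]mulrC mulrC.
have step2 : (Q `^ b) ^+ k * (k * m).+1%:R <= C * ((k * m).+1%:R * (V N)%:R).
  have kE : (k * m).+1%:R <= C * (Q `^ e) ^+ k :> R.
    have : 1 + k%:R * x <= (Q `^ e) ^+ k.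
      apply: le_trans (expR_ge1Dx _) _.
      by rewrite mulrC expRM_natr /x /powR gt_eqF.
    move=> le; apply: le_trans (ler_wpM2l (ltW C0) le).
    rewrite /C mulrDl mul1r mulrDr mulr1 [m%:R / x * (_ * _)]mulrCA mulfVK ?gt_eqF //.
    rewrite -natr1 natrM; have : 0 <= m%:R / x by rewrite divr_ge0 // ltW.
    have : 0 <= k%:R * x by rewrite mulr_ge0 // ltW.
    lra.
  apply: (@le_trans _ _ (C * Y ^+ k)); last by rewrite ler_pM2l // VY.
  apply: le_trans (ler_wpM2l _ kE) _; first by rewrite exprn_ge0 // ltW.
  rewrite mulrCA -exprMn -powRD; last by rewrite (gt_eqF Q0) implybT.
  by rewrite ler_pM2l // lerXn2r // nnegrE ?powR_ge0 // (le_trans _ QY) // powR_ge0.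
have km : 0 < (k * m).+1%:R :> R by rewrite ltr0n.
have step3 : (Q `^ b) ^+ k <= C * (V N)%:R.
  by rewrite -(ler_pM2r km) (le_trans step2) // mulrCA mulrC.
apply: le_trans step1 _.
apply: le_trans (ler_wpM2l _ step3) _; first by rewrite mulr_ge0 // ltW.
by rewrite le_eqVlt; apply/orP; left; apply/eqP; ring.
Qed.

Lemma ln_natM (R : realType) (a b : nat) : (0 < a)%N -> (0 < b)%N ->
  ln ((a * b)%N%:R : R) = ln a%:R + ln b%:R.
Proof. by move=> a0 b0; rewrite natrM lnM ?posrE ?ltr0n. Qed.

Lemma ln_natX (R : realType) (a k : nat) : (0 < a)%N ->
  ln ((a ^ k)%N%:R : R) = k%:R * ln a%:R.
Proof. by move=> a0; rewrite natrX lnXn ?ltr0n // mulr_natl. Qed.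

Lemma ler_ln_nat (R : realType) (a b : nat) : (0 < a)%N -> (a <= b)%N ->
  ln (a%:R : R) <= ln b%:R.
Proof.
by move=> a0 ab; rewrite ler_ln ?posrE ?ltr0n ?ler_nat // (leq_trans a0).
Qed.

(** With [l = ln n], the packing inequality gives [ln s >= 2l - 2dl - 4], and the slice bound then
    gives [(5/32) r <= 3 (ln g - ln s) <= 9dl + 12]. Multiplying by [32/5] gives 57.6 and 76.8. *)
Lemma rank_bound_ln (R : realType) (n g mu s r : nat) (d : R) :
  (0 < n)%N -> (0 < mu)%N -> (0 < g)%N -> 0 <= d ->
  (s ^ 3 * 32 ^ r <= 27 ^ r * g ^ 3)%N -> (n ^ 2 * mu <= s * (4 * g + n ^ 2))%N ->
  ln (g%:R : R) <= (2 + d) * ln n%:R -> (2 - d) * ln n%:R <= ln (mu%:R : R) ->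
  r%:R <= 58 * (d * ln n%:R) + 77.
Proof.
move=> n0 mu0 g0 d0 slice pack gle mule; set l := ln (n%:R : R) in gle mule *.
have l0 : 0 <= l by rewrite ln_ge0 // ler1n.
have s0 : (0 < s)%N.
  case: (posnP s) => // s0; move: pack.
  by rewrite s0 mul0n leqn0 muln_eq0 expn_eq0 (gtn_eqF n0) (gtn_eqF mu0).
have w0 : (0 < 4 * g + n ^ 2)%N by lia.
have : ln ((s ^ 3 * 32 ^ r)%N%:R : R) <= ln ((27 ^ r * g ^ 3)%N%:R : R).
  by apply: ler_ln_nat => //; rewrite muln_gt0 !expn_gt0 s0.
rewrite (@ln_natM R (s ^ 3) (32 ^ r)) ?(@ln_natM R (27 ^ r) (g ^ 3)) ?expn_gt0 ?s0 ?g0 //.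
rewrite !ln_natX // => E1.
have : ln ((n ^ 2 * mu)%N%:R : R) <= ln ((s * (4 * g + n ^ 2))%N%:R : R).
  by apply: ler_ln_nat => //; rewrite muln_gt0 expn_gt0 n0.
rewrite (@ln_natM R (n ^ 2)) ?expn_gt0 ?n0 // ln_natX // (ln_natM R s0 w0) -/l => E2.
have E3 : ln ((4 * g + n ^ 2)%N%:R : R) <= 4 + (2 + d) * l.
  have ln5 : ln (5 : R) <= 4 by have := @le_ln1Dx R 4; rewrite (_ : 1 + 4 = 5); lra.
  apply: (@le_trans _ _ (ln (5 * expR ((2 + d) * l)))); last first.
    by rewrite lnM ?posrE ?expR_gt0 // expRK lerD2r.
  rewrite ler_ln ?posrE ?ltr0n ?mulr_gt0 ?expR_gt0 //.
  have G : (g%:R : R) <= expR ((2 + d) * l).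
    by rewrite -[X in X <= _]lnK ?posrE ?ltr0n // ler_expR.
  have N : ((n ^ 2)%N%:R : R) <= expR ((2 + d) * l).
    rewrite -[X in X <= _]lnK ?posrE ?ltr0n ?expn_gt0 ?n0 // ler_expR ln_natX // -/l.
    by rewrite ler_wpM2r // lerDl.
  rewrite natrD natrM; lra.
(* From [ln (1 + x) <= x] at [x = -5/32], where [1 + x = 27/32]. *)
have E4 : 5 / 32 <= ln (32 : R) - ln 27.
  have := @le_ln1Dx R (- (5 / 32)); rewrite (_ : 1 + - (5 / 32) = 27 / 32); last by field.
  by rewrite ln_div ?posrE //; lra.
have E5 : r%:R * (5 / 32) <= r%:R * (ln (32 : R) - ln 27) by rewrite ler_wpM2l.
have dl0 : 0 <= d * l by rewrite mulr_ge0.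
move: dl0 E1 E2 E3 E5 gle mule; rewrite mulrBr !mulrDl !mulNr.
move: (d * l) (ln s%:R) (ln g%:R) (ln mu%:R) (ln (_ + _)%N%:R) => dl ls lg lm lw.
move: (r%:R * ln 32) (r%:R * ln 27) => x y; lra.
Qed.

(* The constants 240 and 160 leave room for the 58 and 77 of [rank_bound_ln]. *)
Lemma exponent_bound (R : realType) (n g mu r : nat) (eps : R) (d := eps / 240) :
  (0 < n)%N -> (0 < mu)%N -> (0 < g)%N -> 0 < eps -> eps <= 1 ->
  r%:R <= 58 * (d * ln n%:R) + 77 ->
  ln (g%:R : R) <= (2 + d) * ln n%:R -> (2 - d) * ln n%:R <= ln (mu%:R : R) ->
  160 <= eps * ln (n%:R : R) ->
  (((2 * (2 ^ r * g)) ^ 3)%N%:R : R) `^ (4 / 3 - eps + eps / 2) <= ((n.+1./2 ^ 2 * mu ^ 3)%N%:R : R).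
Proof.
move=> n0 mu0 g0 e0 e1 rle gle mule big; set l := ln (n%:R : R) in rle gle mule big *.
have h0 : (0 < n.+1./2)%N by case: n n0 {l rle gle mule big}.
have X2 : (0 < 2 ^ r)%N by rewrite expn_gt0.
have X1 : (0 < 2 ^ r * g)%N by rewrite muln_gt0 X2.
have X0 : (0 < 2 * (2 ^ r * g))%N by rewrite muln_gt0 X1.
have X3 : (0 < (2 * (2 ^ r * g)) ^ 3)%N by rewrite expn_gt0 X0.
have Y0 : (0 < n.+1./2 ^ 2 * mu ^ 3)%N by rewrite muln_gt0 !expn_gt0 h0 mu0.
rewrite -ler_ln ?posrE ?powR_gt0 ?ltr0n //.
rewrite ln_powR (@ln_natM R (_ ^ 2) (_ ^ 3)) ?expn_gt0 ?h0 ?mu0 // !ln_natX //.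
rewrite (ln_natM R (isT : (0 < 2)%N) X1) (ln_natM R X2 g0) ln_natX //.
have hl : l - 1 <= ln (n.+1./2%:R : R).
  have ln2 : ln (2 : R) <= 1 by have := @le_ln1Dx R 1; rewrite (_ : 1 + 1 = 2); lra.
  have : l <= ln ((2 * n.+1./2)%N%:R : R) by apply: ler_ln_nat => //; lia.
  by rewrite ln_natM //; lra.
have ln2 : ln (2 : R) <= 1 by have := @le_ln1Dx R 1; rewrite (_ : 1 + 1 = 2); lra.
have r2 : r%:R * ln (2 : R) <= r%:R by rewrite -[X in _ <= X]mulr1 ler_wpM2l.
have l0 : 0 <= l by rewrite ln_ge0 // ler1n.
apply: (@le_trans _ _ ((4 - 3 / 2 * eps) * (1 + (58 * (d * l) + 77) + (2 + d) * l))).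
  rewrite (_ : (4 / 3 - eps + eps / 2) * _ =
    (4 - 3 / 2 * eps) * (ln 2 + (r%:R * ln 2 + ln g%:R))); last by field.
  by rewrite ler_wpM2l; lra.
pose y := eps * l; have dE : d * l = y / 240 by rewrite /d /y; field.
have y0 : 0 <= eps * y by rewrite !mulr_ge0 // ltW.
(* The right side is at least [8l - 2 - 3dl]. The terms [8l] cancel, and [314 <= (481/240) y]
   suffices, which follows from [160 <= y]. *)
rewrite [(2 + d) * l]mulrDl dE [X in X <= _](_ : _ = 4 * 78 + 236 / 240 * y + 8 * l - 117 * eps
  - 59 / 160 * (eps * y) - 3 * y); last by rewrite /y; field.
move: mule; rewrite mulrBl dE => mule; rewrite -/y in big; lra.
Qed.

Theorem theorem4p7 (R : realType)
    (n : nat -> nat) (G : nat -> finZmodType)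
    (A B : forall t : nat, 'I_(n t) -> {set G t})
    (n_pos : forall t : nat, (0 < n t)%N)
    (n_incr : forall s t : nat, (s < t)%N -> (n s < n t)%N)
    (AB_SDPP : forall t : nat, simultaneous_double_product (A t) (B t))
    (card_G : (ln (#|G t|%:R : R) / ln ((n t)%:R : R)) @[t --> \oo] --> (2 : R))
    (card_AB :
      (\big[Order.min/+oo%E]_(i < n t)
         (lne ((#|A t i| * #|B t i|)%N%:R : R)%:E
            * ((ln ((n t)%:R : R))^-1)%:E)%E)
        @[t --> \oo] --> (2 : R)%:E) :
  forall eps : R, 0 < eps ->
    exists c : R, 0 < c /\
      forall N : nat,
        c * (N.+1%:R `^ (4 / 3 - eps)) <= (trapezoid_val 'I_N.+1)%:R.
Proof.
(* Capping at 1 keeps the exponent [4 / 3 - eps] positive; a smaller [eps] gives a stronger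
   bound. *)
move=> eps0 eps0_gt0; pose eps := Num.min eps0 1.
have e0 : 0 < eps by rewrite lt_min eps0_gt0 ltr01.
have e1 : eps <= 1 by rewrite ge_min lexx orbT.
have ee0 : eps <= eps0 by rewrite ge_min lexx.
pose d := eps / 240.
have d0 : 0 < d by rewrite divr_gt0.
have n_ge t : (t <= n t)%N.
  by elim: t => // t IH; apply: leq_ltn_trans IH (n_incr _ _ (ltnSn t)).
have near1 : \forall t \near \oo, ln (#|G t|%:R : R) / ln ((n t)%:R : R) < 2 + d.
  by apply: (cvgr_lt _ card_G); rewrite ltrDl.
have near2 : \forall t \near \oo, ((2 - d)%:E < \big[Order.min/+oo%E]_(i < n t)
         (lne ((#|A t i| * #|B t i|)%N%:R : R)%:E
            * ((ln ((n t)%:R : R))^-1)%:E))%E.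
  have lt2 : 2 - d < 2 by rewrite ltrBlDr ltrDl.
  exact: (card_AB _ (@nbhs_open_ereal_gt R 2 (fun x => x - d) lt2)).
have near3 : \forall t \near \oo, expR (160 / eps) < (t%:R : R).
  exact: nbhs_infty_gtr.
(* A single large [t] suffices: growth in [N] comes from powers of this one group. *)
have [t [[t1 t2] t3]] : exists t, (ln (#|G t|%:R : R) / ln ((n t)%:R : R) < 2 + d /\
   ((2 - d)%:E < \big[Order.min/+oo%E]_(i < n t)
         (lne ((#|A t i| * #|B t i|)%N%:R : R)%:E
            * ((ln ((n t)%:R : R))^-1)%:E))%E) /\ expR (160 / eps) < (t%:R : R).
  by have [t] := filter_ex (filterI (filterI near1 near2) near3); exists t.
have {t3} big : 160 / eps < ln ((n t)%:R : R).
  rewrite -[X in X < _]expRK ltr_ln ?posrE ?expR_gt0 ?ltr0n //.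
  by apply: lt_le_trans t3 _; rewrite ler_nat.
have l0 : 0 < ln ((n t)%:R : R) by apply: lt_trans big; rewrite divr_gt0.
have gle : ln (#|G t|%:R : R) <= (2 + d) * ln (n t)%:R.
  by move: t1; rewrite ltr_pdivrMr // => /ltW.
have ABge i : (0 < #|A t i| * #|B t i|)%N /\
    (2 - d) * ln (n t)%:R <= ln ((#|A t i| * #|B t i|)%N%:R : R).
  have : ((2 - d)%:E < lne ((#|A t i| * #|B t i|)%N%:R : R)%:E
            * ((ln ((n t)%:R : R))^-1)%:E)%E.
    by apply: lt_le_trans t2 _; rewrite (bigD1 i) //= ge_min lexx.
  (* A pair with an empty set has logarithm minus infinity, against the lower bound. *)
  case: (posnP (#|A t i| * #|B t i|)%N) => [->|ab0].
    by rewrite le0_lneNy // gt0_mulNye // lte_fin invr_gt0.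
  rewrite lne_EFin ?ltr0n // -EFinM lte_fin ltr_pdivlMr // => /ltW.
  by split.
pose i0 := Ordinal (n_pos t).
pose i1 := [arg min_(i < i0) (#|A t i| * #|B t i|)%N].
pose mu := (#|A t i1| * #|B t i1|)%N.
have mu_min i : (mu <= #|A t i| * #|B t i|)%N.
  by rewrite /mu /i1; case: arg_minnP => // j _; apply.
have [mu0 mule] := ABge i1; rewrite -/mu in mu0 mule.
have g0 : (0 < #|G t|)%N by apply/card_gt0P; exists 0.
have sd : sdpp (fun i => mem (A t i)) (fun i => mem (B t i)).
  by case: (AB_SDPP t) => sd1 sd2; split; [exact: sd1 | exact: sd2].
have [psi [psi_fr psi_lt]] := freiman2_exists (G t).
have [s [slice pack]] := sdpp_rank_bound sd mu0 mu_min.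
set r := 'r(_)%g in slice psi_lt.
have rle := rank_bound_ln (n_pos t) mu0 g0 (ltW d0) slice pack gle mule.
have big' : 160 <= eps * ln ((n t)%:R : R).
  by move: big; rewrite ltr_pdivrMr // mulrC => /ltW.
have QY := exponent_bound (n_pos t) mu0 g0 e0 e1 rle gle mule big'.
set L := (2 ^ r * #|G t|)%N in psi_lt QY.
have L0 : (0 < L)%N by rewrite muln_gt0 expn_gt0 g0.
(* The [k]-th power needs a modulus of at least [8 * Q ^+ k] with [Q = (2L)^3], and the
   triangle-free family costs [(k * n t ^ 2).+1], absorbed by the surplus exponent [eps / 2]. *)
have [||||||c [c0 cP]] := @geometric_growth R (fun N => trapezoid_val 'I_N.+1)
   ((2 * L) ^ 3)%N%:R ((n t).+1./2 ^ 2 * mu ^ 3)%N%:R (4 / 3 - eps) (n t ^ 2) (eps / 2).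
- by rewrite ltr1n; apply: (@leq_trans (2 ^ 3)); rewrite // leq_exp2r // leq_pmulr.
- by lra.
- by rewrite divr_gt0.
- exact: QY.
- exact: trapezoid_val_gt0.
- move=> k N kN; rewrite -natrX -natrM ler_nat.
  have := @trapezoid_val_sdpp_power _ _ _ _ psi L N k mu (n_pos t) sd psi_fr psi_lt mu_min.
  have -> a b : ((a ^ 2 * b ^ 3) ^ k = a ^ (k * 2) * b ^ (k * 3))%N.
    by rewrite expnMn -!expnM !(mulnC k).
  apply; rewrite -(ler_nat R); apply: le_trans kN.
  rewrite -natrX -[8]/(8%:R) -natrM ler_nat expnMn leq_mul // -!expnM.
  by rewrite leq_eqVlt (mulnC k) eqxx.
exists c; split=> // N; apply: le_trans (cP N).
rewrite ler_pM2l // ler_powR ?ler1n //.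
by rewrite lerD2l lerN2.
Qed.
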